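(* Let $R$ be a finite $4$-centralizer ring. Then $\Gamma_R$ is integral but not toroidal. Also, $\Gamma_R$ is planar if and only if $|Z(R)| = 1, 2, 3$ or $4$.
   Context: Rings are associative and not assumed to have a multiplicative identity. For a ring $R$, $Z(R)$ is its center and $C_R(r) = \{s \in R : rs = sr\}$ is the centralizer of $r \in R$. $R$ is an $n$-centralizer ring if the set $\{C_R(r) : r \in R\}$ of distinct centralizers has exactly $n$ elements. The commuting graph $\Gamma_R$ of a non-commutative ring $R$ is the simple undirected graph with vertex set $R \setminus Z(R)$ in which two distinct vertices $x,y$ are adjacent if and only if $xy = yx$. A graph is integral if all eigenvalues of its adjacency matrix are integers. The genus $\gamma(\mathcal{G})$ is the smallest non-negative integer $g$ such that $\mathcal{G}$ embeds in the surface obtained by attaching $g$ handles to a sphere; $\mathcal{G}$ is planar if $\gamma(\mathcal{G}) = 0$ and toroidal if $\gamma(\mathcal{G}) = 1$. *)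

(* Defs.v *)
From mathcomp Require Import all_boot all_order all_algebra all_field.
From mathcomp Require Import all_classical all_reals all_analysis.

Set Implicit Arguments.
Unset Strict Implicit.
Unset Printing Implicit Defensive.

Import Order.TTheory GRing.Theory Num.Theory.
Import numFieldNormedType.Exports.

Local Open Scope ring_scope.

(* MathComp rings are unital, so a ring without identity is an additive group
   together with a biadditive associative product [mul], passed explicitly. *)

Definition centralizer (R : finZmodType) (mul : R -> R -> R) (r : R) : {set R} :=
  [set s | mul r s == mul s r]%SET.

Definition center (R : finZmodType) (mul : R -> R -> R) : {set R} :=
  [set z | [forall s, mul z s == mul s z]]%SET.

Definition n_centralizer (R : finZmodType) (mul : R -> R -> R) (n : nat) : Prop :=
  #|[set centralizer mul r | r in [set: R]]%SET| = n.

Record sgraph := SGraph {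
  vertex :> finType;
  adj : rel vertex;
  adj_sym : symmetric adj;
  adj_irr : irreflexive adj }.

Section CommutingGraph.
Variables (R : finZmodType) (mul : R -> R -> R).

Definition noncentral : finType := {x : R | x \notin center mul}.

Definition commuting_adj : rel noncentral :=
  fun x y => (x != y) && (mul (val x) (val y) == mul (val y) (val x)).

Lemma commuting_adj_sym : symmetric commuting_adj.
Proof. by move=> x y; rewrite /commuting_adj eq_sym [mul (val x) _ == _]eq_sym. Qed.

Lemma commuting_adj_irr : irreflexive commuting_adj.
Proof. by move=> x; rewrite /commuting_adj eqxx. Qed.

Definition commuting_graph : sgraph := SGraph commuting_adj_sym commuting_adj_irr.

End CommutingGraph.

Definition adjacency_matrix (G : sgraph) : 'M[algC]_#|G| :=
  \matrix_(i, j) (adj (enum_val i) (enum_val j))%:R.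

Definition integral_graph (G : sgraph) : Prop :=
  forall a : algC, eigenvalue (adjacency_matrix G) a -> a \is a Num.int.

Local Open Scope classical_set_scope.

(* A drawing of G on S without crossings: distinct points for the vertices and,
   for each edge, a simple arc joining its ends whose interior meets no vertex
   and no other edge.  [arc u v] and [arc v u] are the same arc traversed in
   opposite directions; [arc u v] is irrelevant when u and v are not adjacent. *)
Definition embeds_in (K : realType) (X : topologicalType) (G : sgraph)
    (S : set X) : Prop :=
  exists (pt : G -> X) (arc : G -> G -> K -> X),
    [/\ injective pt,
        forall v, S (pt v),
        forall u v, adj u v ->
          [/\ {within `[0, 1], continuous (arc u v)},
              set_inj `[0, 1] (arc u v),
              arc u v @` `[0, 1] `<=` S,
              arc u v 0 = pt u /\ arc u v 1 = pt v
            & forall t, `[0, 1] t -> arc v u t = arc u v (1 - t)],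
        forall u v w t, adj u v -> `]0, 1[ t -> arc u v t <> pt w
      & forall u v u' v' s t, adj u v -> adj u' v' ->
          `]0, 1[ s -> `]0, 1[ t -> arc u v s = arc u' v' t ->
          (u = u' /\ v = v') \/ (u = v' /\ v = u')].

Definition handle_center (K : realType) (i : nat) : K := 1 - 2^-1 ^+ i.
Definition handle_radius (K : realType) (i : nat) : K := 2^-1 ^+ (i + 3).

(* Squared distance from (x, y, z) to the vertical axis of the i-th handle. *)
Definition handle_dist2 (K : realType) (i : nat) (x y : K) : K :=
  (x - handle_center K i) ^+ 2 + y ^+ 2.

(* The unit sphere with g handles attached, inside 3-space.  The closed discs
   of radius [handle_radius i] about ([handle_center i], 0), for i < g, are
   pairwise disjoint and lie in the open unit disc; the two open caps of the
   sphere above and below each of them are removed and replaced by the vertical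
   tube joining their boundary circles.  This is the boundary of a ball with g
   disjoint tunnels, hence the orientable surface of genus g. *)
Definition sphere_with_handles (K : realType) (g : nat) : set (K * K * K) :=
  [set p | let: (x, y, z) := p in
    (x ^+ 2 + y ^+ 2 + z ^+ 2 = 1 /\
     forall i, (i < g)%N -> handle_radius K i ^+ 2 <= handle_dist2 i x y)
    \/
    (x ^+ 2 + y ^+ 2 + z ^+ 2 <= 1 /\
     exists2 i, (i < g)%N & handle_dist2 i x y = handle_radius K i ^+ 2)].

Arguments sphere_with_handles : clear implicits.

Definition has_genus (K : realType) (G : sgraph) (g : nat) : Prop :=
  embeds_in K G (sphere_with_handles K g) /\
  forall h, (h < g)%N -> ~ embeds_in K G (sphere_with_handles K h).

Definition planar (K : realType) (G : sgraph) : Prop := has_genus K G 0.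
Definition toroidal (K : realType) (G : sgraph) : Prop := has_genus K G 1.

(* Main.v *)
Require Import Defs.
From mathcomp Require Import all_boot all_order all_algebra all_field.
From mathcomp Require Import all_classical all_reals all_analysis.
From Stdlib Require Import Btauto.
From mathcomp Require Import zify ring lra.
Import Defs.

(** Why the theorem holds.  A finite ring R with four centralizers is the union
of three proper centralizers, and a group that is a union of three proper
subgroups but of no two of them has these subgroups meeting pairwise in the
same set, here the center Z.  Hence two noncentral elements commute exactly
when they differ by a central element, there are three noncentral cosets of Z,
and the commuting graph is the disjoint union of three complete graphs on
m = |Z| vertices ([commute_center_coset], [noncentral_cosets]).

Its adjacency matrix plus the identity, B, satisfies B^2 = mB, so that -1 and
m - 1 are the only possible eigenvalues.  For m <= 4 three copies of K4 are
drawn side by side with straight edges and moved to the sphere by stereographic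
projection ([three_K4_embed]), so the graph is planar, and not toroidal because
its genus is 0.  For m >= 5 the graph contains two disjoint copies of K5 and a
further vertex, and it remains to see that it embeds neither in the sphere nor
in the torus.

Both cases reduce to one statement ([no_two_K5_arcs]): two disjoint copies of K5
cannot be drawn in the torus.  Indeed the sphere minus the point drawn for the
further vertex is a plane, and a plane sits inside a torus.

That statement is proved by counting crossings modulo 2, with no use of the
Jordan curve theorem.  For disjoint arcs alpha and beta in the plane the map
(s, t) |-> alpha(s) - beta(t) avoids the origin, so its values along the
boundary of the unit square cross the positive horizontal axis an even number
of times.  Two consequences follow.

- A pair of independent edges ab and cd of a planar drawing gives a linear
  equation modulo 2, and the sum of the fifteen equations provided by K5 reads
  0 = 1 ([tournament_parity]).  The argument survives on an annulus, seen as a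
  plane with a periodic coordinate ([no_K5_annulus]).

- Two disjoint closed curves on the torus have proportional homology classes:
  were the classes independent, the difference of long lifts of the curves
  would satisfy the hypotheses of the Poincare-Miranda theorem and vanish
  somewhere ([far_loops_parallel]).

With two disjoint copies of K5 in the torus, the second fact makes all cycles of
one of the copies homologous to multiples of a single class.  That copy then
lifts to an annulus covering the torus, which the first fact excludes
([no_K5_torus_parallel]).

The arcs are only continuous; compactness replaces them by finite sequences of
points with small steps that stay far from each other, and all the topology
above is carried out on such sequences. *)

Set Implicit Arguments.
Unset Strict Implicit.
Unset Printing Implicit Defensive.
Import Order.TTheory GRing.Theory Num.Theory.
Import numFieldNormedType.Exports.
Local Open Scope ring_scope.

(** * Rings with four centralizers *)

Section FourCentralizers.
(* The names of finite set theory must prevail over those of classical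
   sets inside this section. *)
Import mathcomp.boot.finset.
Local Open Scope set_scope.
Variables (R : finZmodType) (mul : R -> R -> R).
Hypothesis mulDl : left_distributive mul +%R.
Hypothesis mulDr : right_distributive mul +%R.

Local Notation Z := (center mul).
Local Notation C := (centralizer mul).

Lemma centralizerP r s : reflect (mul r s = mul s r) (s \in C r).
Proof. by rewrite inE; apply: eqP. Qed.

Lemma centralizerC r s : (s \in C r) = (r \in C s).
Proof. by rewrite !inE eq_sym. Qed.

Lemma centralizer_self r : r \in C r.
Proof. exact/centralizerP. Qed.

Lemma ring_centerP z : reflect (forall s, s \in C z) (z \in Z).
Proof.
rewrite inE; apply: (iffP forallP) => h s; first by rewrite inE h.
by have := h s; rewrite inE.
Qed.

Lemma centralizerB r s t : s \in C r -> t \in C r -> s - t \in C r.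
Proof.
have mulBr x y z : mul x (y - z) = mul x y - mul x z.
  by apply: (addIr (mul x z)); rewrite subrK -mulDr subrK.
have mulBl x y z : mul (y - z) x = mul y x - mul z x.
  by apply: (addIr (mul z x)); rewrite subrK -mulDl subrK.
by move=> /centralizerP rs /centralizerP rt; apply/centralizerP; rewrite mulBr mulBl rs rt.
Qed.

Lemma centralizer0 r : 0 \in C r.
Proof. by rewrite -(subrr r) centralizerB ?centralizer_self. Qed.

Lemma centralizerD r s t : s \in C r -> t \in C r -> s + t \in C r.
Proof.
by move=> rs rt; rewrite -[t]opprK -[- t]sub0r !centralizerB ?centralizer0.
Qed.

Lemma ring_center0 : 0 \in Z.
Proof. by apply/ring_centerP => s; rewrite centralizerC centralizer0. Qed.

Lemma ring_centerB x y : x \in Z -> y \in Z -> x - y \in Z.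
Proof.
move=> /ring_centerP hx /ring_centerP hy; apply/ring_centerP => s; rewrite centralizerC.
by rewrite centralizerB // centralizerC.
Qed.

Lemma ring_centerN x : x \in Z -> - x \in Z.
Proof. by move=> hx; rewrite -sub0r ring_centerB ?ring_center0. Qed.

Lemma ring_centerD x y : x \in Z -> y \in Z -> x + y \in Z.
Proof. by move=> hx hy; rewrite -[y]opprK ring_centerB ?ring_centerN. Qed.

Lemma mem_addl_centralizer r s t : s \in C r -> (s + t \in C r) = (t \in C r).
Proof.
move=> rs; apply/idP/idP => [|rt]; last exact: centralizerD.
by move=> rst; rewrite -[t](addKr s) addrC centralizerB.
Qed.

(** Take s outside C a and t outside C b.  If neither of them escapes both
subgroups then s is in C b and t in C a, and s + t escapes both. *)
Lemma centralizer_not_union2 a b : C a != setT -> C b != setT ->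
  exists c, (c \notin C a) && (c \notin C b).
Proof.
have proper r : C r != setT -> exists s, s \notin C r.
  move=> h; apply/existsP; apply: contraR h => /existsPn h.
  by apply/eqP/setP => s; rewrite [RHS]in_setT; apply: negbNE; apply: h.
move=> /proper[s sa] /proper[t tb].
have [sb|sb] := boolP (s \in C b); last by exists s; rewrite sa.
have [ta|ta] := boolP (t \in C a); last by exists t; rewrite ta.
exists (s + t); rewrite (mem_addl_centralizer _ sb) tb andbT addrC.
by rewrite (mem_addl_centralizer _ ta).
Qed.

(** There is t outside C a and C b.  It lies in C c, and so does s + t,
which is outside C a and C b too. *)
Lemma centralizer_union3 a b c : C a != setT -> C b != setT ->
  (forall s, [|| s \in C a, s \in C b | s \in C c]) ->
  forall s, s \in C a -> s \in C b -> s \in C c.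
Proof.
move=> ha hb cover s sa sb.
have [t /andP[ta tb]] := centralizer_not_union2 ha hb.
have tc : t \in C c by have := cover t; rewrite (negPf ta) (negPf tb).
have := cover (s + t).
rewrite (mem_addl_centralizer _ sa) (mem_addl_centralizer _ sb) (negPf ta) (negPf tb) /=.
by rewrite addrC mem_addl_centralizer.
Qed.

Hypothesis R4 : n_centralizer mul 4.

Let proper_centralizers : {set {set R}} := [set C r | r in [set: R]] :\ setT.

Lemma card_proper_centralizers : #|proper_centralizers| = 3%N.
Proof.
have T_in : [set: R] \in [set C r | r in [set: R]].
  apply/imsetP; exists 0 => //; apply/setP => s.
  by rewrite in_setT centralizerC centralizer0.
by have := cardsD1 setT [set C r | r in [set: R]]; rewrite T_in R4 => -[].
Qed.

Lemma mem_proper_centralizers r : (C r \in proper_centralizers) = (r \notin Z).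
Proof.
rewrite in_setD1 imset_f ?andbT; last by rewrite in_setT.
congr negb; apply/eqP/idP => [CT|rZ].
  by apply/ring_centerP => s; rewrite CT in_setT.
by apply/setP => s; rewrite in_setT; move/ring_centerP: rZ => ->.
Qed.

(** An element common to two of the three proper centralizers belongs to
the third, because the three of them cover R; it is then in all centralizers. *)
Lemma centralizers_meet a b s : a \notin Z -> b \notin Z -> C a != C b ->
  s \in C a -> s \in C b -> s \in Z.
Proof.
rewrite -!mem_proper_centralizers => ha hb ab sa sb.
have : #|proper_centralizers :\ C a :\ C b| == 1%N.
  have := card_proper_centralizers; rewrite (cardsD1 (C a)) ha.
  by rewrite (cardsD1 (C b)) in_setD1 eq_sym ab hb !add1n => -[<-].
case/cards1P => D hD.
have [c DE] : exists c, D = C c.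
  have : D \in [set D] by rewrite inE.
  by rewrite -hD !inE => /and4P[_ _ _ /imsetP[c _ ->]]; exists c.
have all_in r : r \notin Z -> [|| C r == C a, C r == C b | C r == C c].
  rewrite -mem_proper_centralizers => hr.
  case: eqVneq => //= ra; case: eqVneq => //= rb.
  by rewrite -DE -in_set1 -hD !in_setD1 rb ra -in_setD1.
have aT : C a != setT by move: ha; rewrite in_setD1 => /andP[].
have bT : C b != setT by move: hb; rewrite in_setD1 => /andP[].
have sc : s \in C c.
  apply: (centralizer_union3 aT bT _ sa sb) => r.
  have [rZ|/all_in] := boolP (r \in Z).
    by rewrite centralizerC; move/ring_centerP: rZ => ->.
  by case/or3P => /eqP <-; rewrite centralizer_self ?orbT.
apply/ring_centerP => r; rewrite centralizerC.
have [rZ|/all_in] := boolP (r \in Z); first by move/ring_centerP: rZ => ->.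
by case/or3P => /eqP ->.
Qed.

(** If x and y commute they have the same centralizer.  For b with another
centralizer, x + b and y + b escape both C x and C b, so they share the third
proper centralizer.  The difference x - y lies in it and in C x, which meet in
the center. *)
Lemma commute_center_coset x y : x \notin Z -> y \notin Z ->
  (mul x y == mul y x) = (x - y \in Z).
Proof.
move=> hx hy; apply/eqP/idP => [/centralizerP xy|xyZ]; last first.
  apply/centralizerP; rewrite -[y](subKr x) centralizerB ?centralizer_self //.
  by rewrite centralizerC; move/ring_centerP: xyZ.
have Cxy : C x = C y.
  apply: contraNeq (hy) => ne.
  exact: centralizers_meet hx hy ne xy (centralizer_self y).
have [b hb xb] : exists2 b, b \notin Z & C b != C x.
  have : (0 < #|proper_centralizers :\ C x|)%N.
    have := card_proper_centralizers.
    by rewrite (cardsD1 (C x)) mem_proper_centralizers hx add1n => -[->].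
  case/card_gt0P => D; rewrite in_setD1 => /andP[Dx].
  move=> /[dup] hD; rewrite in_setD1 => /andP[_ /imsetP[b _ DE]].
  by exists b; rewrite -?DE // -mem_proper_centralizers -DE.
have bx : b \notin C x.
  apply: contraNN (hb) => bx.
  exact: centralizers_meet hb hx xb (centralizer_self b) bx.
have third s : s \notin Z -> C s = C x ->
    [/\ s + b \notin C x, s + b \notin C b & s + b \notin Z].
  move=> hs sx; have sC : s \in C x by rewrite -sx centralizer_self.
  have h1 : s + b \notin C x by rewrite mem_addl_centralizer.
  split=> //; last by apply: contraNN (h1) => /ring_centerP h; rewrite centralizerC.
  rewrite addrC mem_addl_centralizer ?centralizer_self //.
  apply: contraNN (hs) => sb; apply: (centralizers_meet hx hb) sC sb.
  by rewrite eq_sym.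
have [x1 x2 x3] := third x hx erefl.
have [y1 y2 y3] := third y hy (esym Cxy).
have Cxyb : C (x + b) = C (y + b).
  apply/eqP; apply: contraT => ne; exfalso.
  have xs : C (x + b) != C x by apply: contraNneq (x1) => <-; rewrite centralizer_self.
  have xt : C (x + b) != C b by apply: contraNneq (x2) => <-; rewrite centralizer_self.
  have ys : C (y + b) != C x by apply: contraNneq (y1) => <-; rewrite centralizer_self.
  have yt : C (y + b) != C b by apply: contraNneq (y2) => <-; rewrite centralizer_self.
  have : (4 <= #|proper_centralizers|)%N.
    have m1 : C x \in proper_centralizers by rewrite mem_proper_centralizers.
    have m2 : C b \in proper_centralizers :\ C x.
      by rewrite in_setD1 xb mem_proper_centralizers.
    have m3 : C (x + b) \in proper_centralizers :\ C x :\ C b.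
      by rewrite in_setD1 xt in_setD1 xs mem_proper_centralizers.
    have m4 : C (y + b) \in proper_centralizers :\ C x :\ C b :\ C (x + b).
      by rewrite in_setD1 eq_sym ne in_setD1 yt in_setD1 ys mem_proper_centralizers.
    by rewrite (cardsD1 (C x)) m1 (cardsD1 (C b)) m2 (cardsD1 (C (x + b))) m3
      (cardsD1 (C (y + b))) m4.
  by rewrite card_proper_centralizers.
have xyb : x - y \in C (x + b).
  have -> : x - y = (x + b) - (y + b) by rewrite opprD addrACA subrr addr0.
  by rewrite centralizerB ?centralizer_self // Cxyb centralizer_self.
apply: (centralizers_meet hx x3 _ _ xyb).
  by apply: contraNneq (x1) => ->; rewrite centralizer_self.
by rewrite centralizerB ?centralizer_self // Cxy centralizer_self.
Qed.

(** One coset of noncentral elements for each proper centralizer. *)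
Lemma noncentral_cosets : exists rep : nat -> R,
  [/\ forall k, (k < 3)%N -> rep k \notin Z,
      forall x, x \notin Z -> exists2 k, (k < 3)%N & x - rep k \in Z
    & forall k l, (k < 3)%N -> (l < 3)%N -> rep k - rep l \in Z -> k = l].
Proof.
have inv D : D \in proper_centralizers -> exists r, D = C r.
  by rewrite in_setD1 => /andP[_ /imsetP[r _ ->]]; exists r.
have repE k : exists r, (k < 3)%N -> nth setT (enum proper_centralizers) k = C r.
  have [k3|] := boolP (k < 3)%N; last by exists 0.
  have [r rE] : exists r, nth setT (enum proper_centralizers) k = C r.
    by apply: inv; rewrite -mem_enum mem_nth // -cardE card_proper_centralizers.
  by exists r.
have [rep {}repE] := choice repE.
have repZ k : (k < 3)%N -> rep k \notin Z.
  move=> k3; rewrite -mem_proper_centralizers -repE // -mem_enum mem_nth //.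
  by rewrite -cardE card_proper_centralizers.
exists rep; split=> // [x hx|k l k3 l3].
  have : C x \in enum proper_centralizers by rewrite mem_enum mem_proper_centralizers.
  case/(nthP setT) => k; rewrite -cardE card_proper_centralizers => k3 Ck.
  exists k => //; rewrite -commute_center_coset ?repZ //.
  by apply/eqP/centralizerP; rewrite -Ck repE // centralizer_self.
rewrite -commute_center_coset ?repZ // => /eqP/centralizerP kl.
apply/eqP; rewrite -(nth_uniq setT _ _ (enum_uniq proper_centralizers));
  rewrite -?cardE ?card_proper_centralizers // !repE //.
apply: contraT => ne; move: (repZ l l3).
by rewrite (centralizers_meet (repZ k k3) (repZ l l3) ne kl (centralizer_self _)).
Qed.

End FourCentralizers.

(** * The spectrum of a disjoint union of cliques *)

Section DisjointCliques.
Variable G : sgraph.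
Let same_clique (x y : G) : bool := (x == y) || adj x y.

(** Let B be the adjacency matrix plus the identity.  The entries of B^2
count the common members of two cliques, so B^2 = mB and an eigenvalue a
satisfies (a + 1)^2 = m (a + 1). *)
Lemma integral_disjoint_cliques (m : nat) : transitive same_clique ->
  (forall x : G, #|[pred y | same_clique x y]| = m) -> integral_graph G.
Proof.
move=> tr card_m a /eigenvalueP[v vA v0].
have sym : symmetric same_clique.
  by move=> x y; rewrite /same_clique eq_sym adj_sym.
pose A := adjacency_matrix G; pose B : 'M[algC]_#|G| := A + 1%:M.
have BE i j : B i j = (same_clique (enum_val i) (enum_val j))%:R.
  rewrite !mxE /same_clique -(inj_eq enum_val_inj).
  by case: eqVneq => [->|]; rewrite ?adj_irr ?add0r ?addr0.
have BB : B *m B = m%:R *: B.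
  apply/matrixP => i j; rewrite mxE [RHS]mxE BE.
  under eq_bigr => k _ do rewrite !BE -natrM mulnb.
  rewrite -natr_sum -natrM; congr _%:R.
  rewrite -(big_enum_val (fun x => (same_clique (enum_val i) x &&
    same_clique x (enum_val j)) : nat)) /=.
  case eij: (same_clique (enum_val i) (enum_val j)).
    rewrite muln1 -(card_m (enum_val i)) -sum1_card big_mkcond [RHS]big_mkcond /=.
    apply: eq_bigr => x _; rewrite inE.
    case eix: (same_clique (enum_val i) x) => //=.
    by rewrite (tr _ _ _ _ eij) // sym.
  rewrite muln0 big1 // => x _; case eix: (same_clique (enum_val i) x) => //=.
  case exj: (same_clique x _) => //.
  by rewrite (tr _ _ _ eix exj) in eij.
have vB : v *m B = (a + 1) *: v by rewrite mulmxDr vA mulmx1 scalerDl scale1r.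
have vBB : (a + 1) *: ((a + 1) *: v) = m%:R *: ((a + 1) *: v).
  by rewrite -[in RHS]vB scalemxAr -BB mulmxA vB -scalemxAl vB.
have : ((a + 1 - m%:R) * (a + 1)) *: v = 0.
  by rewrite -scalerA scalerBl vBB subrr.
move/eqP; rewrite scaler_eq0 (negPf v0) orbF mulf_eq0 => /orP[].
  by rewrite subr_eq0 => /eqP aE; rewrite -[a](addrK 1) aE rpredB ?rpred1 ?rpred_nat.
by rewrite addr_eq0 => /eqP ->; rewrite rpredN rpred1.
Qed.

End DisjointCliques.

(** * Crossings of a ray modulo 2 *)

Section CrossingParity.
Variable K : realType.
Implicit Types u v w : K * K.

(** The half-plane is half-open so that exactly one of u and - u is in it
when u is not 0. *)
Definition upper u : bool := (0 < u.2) || ((u.2 == 0) && (0 < u.1)).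
Definition cross u v : K := u.1 * v.2 - u.2 * v.1.
(** Whether the segment uv crosses the positive horizontal axis, for a
segment that avoids 0: its ends are on different sides of the axis, and the sign
of the cross product tells on which side of 0 it meets the axis. *)
Definition ray_crossing u v : bool :=
  (upper u (+) upper v) && (if upper u then cross u v < 0 else 0 < cross u v).
(** An open half-plane bounded by a line through 0: the convex hull of the
points avoids 0.  This form of the condition is invariant under invertible linear maps. *)
Definition half_plane (s : seq (K * K)) : Prop :=
  exists l : K * K, all (fun u => 0 < l.1 * u.1 + l.2 * u.2) s.

Lemma half_plane_sub s s' :
  {subset s' <= s} -> half_plane s -> half_plane s'.
Proof. by move=> ss [l /allP h]; exists l; apply/allP => u /ss /h. Qed.

Lemma ray_crossingC u v : ray_crossing u v = ray_crossing v u.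
Proof.
rewrite /ray_crossing addbC; case: (upper u) (upper v) => [] [] //=.
  by rewrite /cross; apply/idP/idP; lra.
by rewrite /cross; apply/idP/idP; lra.
Qed.

Lemma ray_crossing_same u v : upper u = upper v -> ray_crossing u v = false.
Proof. by move=> e; rewrite /ray_crossing e addbb. Qed.

Lemma upperN u : u != 0 -> upper (- u) = ~~ upper u.
Proof.
case: u => x y; rewrite -pair_eqE /= negb_and /upper /= => h.
by apply/idP/idP; lra.
Qed.

Lemma upper_ge0 u : upper u -> 0 <= u.2 /\ (u.2 = 0 -> 0 < u.1).
Proof. by rewrite /upper => h; split; [|move=> e]; lra. Qed.

Lemma lower_le0 u : upper u = false -> u.2 <= 0 /\ (u.2 = 0 -> u.1 <= 0).
Proof. by move/negbT; rewrite /upper => h; split; [|move=> e]; lra. Qed.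

Lemma cross_neq0 u v :
  half_plane [:: u; v] -> upper u -> upper v = false -> cross u v != 0.
Proof.
move=> [[a b] /= /and3P[hu hv _]] /upper_ge0[u2 u1] /lower_le0[v2 v1].
apply/eqP => c0; rewrite /cross in c0.
have e : (a * u.1 + b * u.2) * v.2 = u.2 * (a * v.1 + b * v.2).
  by rewrite -[RHS]addr0 -(mulr0 a) -c0; ring.
have l0 : (a * u.1 + b * u.2) * v.2 <= 0 by rewrite mulr_ge0_le0 // ltW.
have r0 : 0 <= u.2 * (a * v.1 + b * v.2) by rewrite mulr_ge0 // ltW.
have v20 : v.2 = 0.
  have /eqP : (a * u.1 + b * u.2) * v.2 = 0 by lra.
  by rewrite mulf_eq0 gt_eqF //= => /eqP.
have u20 : u.2 = 0.
  have /eqP : u.2 * (a * v.1 + b * v.2) = 0 by lra.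
  by rewrite mulf_eq0 orbC gt_eqF //= => /eqP.
move: hu hv (u1 u20) (v1 v20); rewrite u20 v20 !mulr0 !addr0 => au av u0 v0.
have a0 : 0 < a by rewrite -(pmulr_lgt0 _ u0).
by move: av; rewrite pmulr_rgt0 // ltNge v0.
Qed.

(** The segment and its opposite cross, between them, the positive axis as
often as the segment crosses the whole axis. *)
Lemma ray_crossing_opp u v : half_plane [:: u; v] ->
  ray_crossing (- u) (- v) = ray_crossing u v (+) (upper u (+) upper v).
Proof.
move=> huv; have huv' : half_plane [:: v; u].
  by apply: half_plane_sub huv => w; rewrite !inE orbC.
have n0 w : w \in [:: u; v] -> w != 0.
  case: huv => l /allP h /h; apply: contraTneq => ->.
  by rewrite /= !mulr0 addr0 ltxx.
rewrite /ray_crossing !upperN ?n0 ?inE ?eqxx ?orbT // addbN addNb negbK.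
have -> : cross (- u) (- v) = cross u v by rewrite /cross /=; ring.
case hu: (upper u) (upper v) (cross_neq0 huv) (cross_neq0 huv') => [] [] //=.
- by move=> /(_ isT erefl) c0 _; rewrite addbT -leNgt le_eqVlt eq_sym (negPf c0).
- move=> _ /(_ isT erefl) c0; rewrite addbT -leNgt le_eqVlt.
  suff -> : (cross u v == 0) = false by [].
  by apply: contraNF c0 => /eqP; rewrite /cross => c; apply/eqP; lra.
Qed.

(** The vector u (v x w) + v (w x u) + w (u x v) vanishes.  If u x w were
positive, a linear form positive on u, v and w would give v x w > 0; then the
terms of the second coordinate of this vector have the same sign and are all 0,
which puts u and v on the axis, although u x v < 0. *)
Lemma cross_sign u v w : half_plane [:: u; v; w] ->
  upper v = upper w -> upper u = ~~ upper v ->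
  cross u v < 0 -> cross u w < 0.
Proof.
move=> h evw euv uv; case: ltgtP => // [wu|wu0]; last first.
  have huw : half_plane [:: u; w].
    by apply: half_plane_sub h => x; rewrite !inE => /orP[]->; rewrite ?orbT.
  have hwu : half_plane [:: w; u].
    by apply: half_plane_sub huw => x; rewrite !inE orbC.
  case ew: (upper w); last first.
    by have := cross_neq0 huw; rewrite wu0 eqxx euv evw ew => /(_ isT erefl).
  have := cross_neq0 hwu ew; rewrite euv evw ew => /(_ erefl).
  have -> : cross w u = - cross u w by rewrite /cross; ring.
  by rewrite wu0 oppr0 eqxx.
case: h => [[a b] /= /and4P[hu hv hw _]].
have vw : 0 < cross v w.
  suff : 0 < (a * u.1 + b * u.2) * cross v w by rewrite pmulr_rgt0.
  have -> : (a * u.1 + b * u.2) * cross v w =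
    (a * v.1 + b * v.2) * cross u w + (a * w.1 + b * w.2) * - cross u v.
    by rewrite /cross; ring.
  by rewrite addr_gt0 // mulr_gt0 // oppr_gt0.
have e : u.2 * cross v w = v.2 * cross u w + w.2 * - cross u v.
  by rewrite /cross; ring.
have sgn3 : 0 <= v.2 -> 0 <= w.2 -> u.2 <= 0 -> v.2 = 0 /\ u.2 = 0.
  move=> v2 w2 u2.
  have p1 : 0 <= v.2 * cross u w by rewrite mulr_ge0 // ltW.
  have p2 : 0 <= w.2 * - cross u v by rewrite mulr_ge0 // oppr_ge0 ltW.
  have p3 : u.2 * cross v w <= 0 by rewrite mulr_le0_ge0 // ltW.
  split.
    have /eqP : v.2 * cross u w = 0 by lra.
    by rewrite mulf_eq0 (gt_eqF wu) orbF => /eqP.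
  have /eqP : u.2 * cross v w = 0 by lra.
  by rewrite mulf_eq0 (gt_eqF vw) orbF => /eqP.
have sgn3' : v.2 <= 0 -> w.2 <= 0 -> 0 <= u.2 -> v.2 = 0 /\ u.2 = 0.
  move=> v2 w2 u2.
  have p1 : v.2 * cross u w <= 0 by rewrite mulr_le0_ge0 // ltW.
  have p2 : w.2 * - cross u v <= 0 by rewrite mulr_le0_ge0 // oppr_ge0 ltW.
  have p3 : 0 <= u.2 * cross v w by rewrite mulr_ge0 // ltW.
  split.
    have /eqP : v.2 * cross u w = 0 by lra.
    by rewrite mulf_eq0 (gt_eqF wu) orbF => /eqP.
  have /eqP : u.2 * cross v w = 0 by lra.
  by rewrite mulf_eq0 (gt_eqF vw) orbF => /eqP.
suff [v0 u0] : v.2 = 0 /\ u.2 = 0.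
  by move: uv; rewrite /cross v0 u0 mulr0 mul0r subrr ltxx.
case ev: (upper v) evw euv => /= /esym ew eu.
  by apply: sgn3; [case/upper_ge0: ev|case/upper_ge0: ew|case/lower_le0: eu].
by apply: sgn3'; [case/lower_le0: ev|case/lower_le0: ew|case/upper_ge0: eu].
Qed.

Lemma ray_crossing_lone u v w : half_plane [:: u; v; w] ->
  upper v = upper w -> upper u = ~~ upper v -> ray_crossing u v = ray_crossing w u.
Proof.
move=> h evw euv.
have h' : half_plane [:: u; w; v].
  apply: half_plane_sub h => x; rewrite !inE.
  by case/or3P=> ->; rewrite ?orbT.
have lt0 : (cross u v < 0) = (cross u w < 0).
  apply/idP/idP; first exact: cross_sign h evw euv.
  by apply: (cross_sign h'); rewrite -?evw.
have n0 : cross u v != 0 /\ cross u w != 0.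
  have hs x : x \in [:: v; w] -> cross u x != 0.
    move=> xvw; have hux : half_plane [:: u; x].
      apply: half_plane_sub h => y; rewrite !inE in xvw *.
      by case/orP=> /eqP->; rewrite ?eqxx ?xvw ?orbT.
    have hxu : half_plane [:: x; u].
      by apply: half_plane_sub hux => y; rewrite !inE orbC.
    have eux : upper u = ~~ upper x.
      by move: xvw; rewrite !inE => /orP[] /eqP->; rewrite -?evw.
    case ex: (upper x) eux => /= eu; last exact: cross_neq0.
    have -> : cross u x = - cross x u by rewrite /cross; ring.
    by rewrite oppr_eq0 cross_neq0.
  by split; apply: hs; rewrite !inE eqxx ?orbT.
rewrite [RHS]ray_crossingC /ray_crossing -evw; congr andb; case: ifP => // _.
case: n0 => n1 n2; by rewrite !lt0r n1 n2 !leNgt lt0.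
Qed.

(** A closed triangle whose convex hull avoids 0 does not wind around 0. *)
Lemma ray_crossing_triangle u v w : half_plane [:: u; v; w] ->
  ray_crossing u v (+) ray_crossing v w (+) ray_crossing w u = false.
Proof.
move=> h.
have rot x y z : {subset [:: x; y; z] <= [:: u; v; w]} -> half_plane [:: x; y; z].
  by move=> s; apply: half_plane_sub h.
case evw: (upper v == upper w).
  move/eqP: evw => evw; rewrite (ray_crossing_same evw) addbF.
  case euv: (upper u == upper v).
    move/eqP: euv => euv.
    by rewrite (ray_crossing_same euv) (ray_crossing_same (esym (etrans euv evw))).
  rewrite (ray_crossing_lone h evw) ?addbb //.
  by move: euv; do 2! case: (upper _).
case euw: (upper w == upper u).
  move/eqP: euw => euw; rewrite (ray_crossing_same euw) addbF.
  rewrite (@ray_crossing_lone v w u) ?addbb //.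
  - by apply: rot => x; rewrite !inE; case/or3P=> ->; rewrite ?orbT.
  - by move: evw; do 2! case: (upper _).
have euv : upper u = upper v.
  by move: evw euw; do 3! case: (upper _).
rewrite (ray_crossing_same euv) /= (@ray_crossing_lone w u v) ?addbb //.
- by apply: rot => x; rewrite !inE; case/or3P=> ->; rewrite ?orbT.
- by move: euw; do 2! case: (upper _).
Qed.

Lemma ray_crossing_square u u' v v' : half_plane [:: u; u'; v; v'] ->
  ray_crossing u u' (+) ray_crossing v v' = ray_crossing u v (+) ray_crossing u' v'.
Proof.
move=> h; have t1 : half_plane [:: u; u'; v].
  by apply: half_plane_sub h => x; rewrite !inE; case/or3P=> ->; rewrite ?orbT.
have t2 : half_plane [:: v; u'; v'].
  by apply: half_plane_sub h => x; rewrite !inE; case/or3P=> ->; rewrite ?orbT.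
move: (ray_crossing_triangle t1) (ray_crossing_triangle t2).
rewrite (ray_crossingC v u') (ray_crossingC v u) (ray_crossingC v' v).
by do 5! case: (ray_crossing _ _).
Qed.

End CrossingParity.

Definition steps (T : Type) (x : T) (s : seq T) : seq (T * T) := zip (x :: s) s.

Lemma steps_cons (T : Type) (x y : T) s :
  steps x (y :: s) = (x, y) :: steps y s.
Proof. by []. Qed.

Lemma mem_steps (T : eqType) (x : T) s e :
  e \in steps x s -> (e.1 \in x :: s) && (e.2 \in x :: s).
Proof.
elim: s x => [//|y s IH] x; rewrite steps_cons inE => /orP[/eqP->|/IH] /=.
  by rewrite !inE !eqxx ?orbT.
by rewrite ![_ \in [:: x, y & s]]inE => /andP[-> ->]; rewrite !orbT.
Qed.

Lemma path_steps (T : eqType) (r : rel T) (x : T) s e :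
  path r x s -> e \in steps x s -> r e.1 e.2.
Proof.
elim: s x => [//|y s IH] x /= /andP[rxy p]; rewrite steps_cons inE.
by case/orP=> [/eqP->|/(IH _ p)].
Qed.

Section Winding.
Variable K : realType.
Implicit Types u v w : K * K.

(** The number of crossings of the positive horizontal axis modulo 2; for a
closed path it is the winding number around 0 modulo 2. *)
Fixpoint winding (A : Type) (f : A -> K * K) (x : A) (s : seq A) : bool :=
  if s is y :: s' then ray_crossing (f x) (f y) (+) winding f y s' else false.

Lemma eq_winding (A : Type) (f g : A -> K * K) x s :
  f =1 g -> winding f x s = winding g x s.
Proof. by move=> fg; elim: s x => //= y s IH x; rewrite !fg IH. Qed.

Lemma winding_side (A : eqType) (P : pred (K * K)) (f : A -> K * K) x s :
  (forall u v, P u -> P v -> ray_crossing u v = false) ->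
  (forall p, p \in x :: s -> P (f p)) -> winding f x s = false.
Proof.
move=> hP; elim: s x => //= y s IH x hf.
by rewrite hP ?hf ?inE ?eqxx ?orbT // IH // => p hp; rewrite hf // inE hp orbT.
Qed.

Lemma winding_right (A : eqType) (f : A -> K * K) x s :
  (forall p, p \in x :: s -> 0 < (f p).1) ->
  winding f x s = upper (f x) (+) upper (f (last x s)).
Proof.
elim: s x => [|y s IH] x hf /=; first by rewrite addbb.
rewrite IH => [|p hp]; last by rewrite hf // inE hp orbT.
rewrite addbA; congr addb.
have hx : 0 < (f x).1 by rewrite hf // mem_head.
have hy : 0 < (f y).1 by rewrite hf // !inE eqxx orbT.
have H (u v : K * K) : 0 < u.1 -> 0 < v.1 -> upper u -> upper v = false -> cross u v < 0.
  move=> u1 v1 /upper_ge0[u2 _] /lower_le0[v2 v2'].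
  have {v2' v2} v2 : v.2 < 0.
    by rewrite lt_neqAle v2 andbT; apply: contraTneq v1 => /v2'; rewrite -leNgt.
  rewrite /cross subr_lt0 (@lt_le_trans _ _ 0) ?pmulr_rlt0 //.
  by rewrite mulr_ge0 // ltW.
rewrite /ray_crossing; case ux: (upper (f x)); case uy: (upper (f y)) => //=.
  by rewrite H.
by move: (H _ _ hy hx uy ux); rewrite /cross => h; rewrite (_ : _ < _ = true) //; lra.
Qed.

Lemma winding_opp (A : eqType) (f : A -> K * K) x s :
  (forall e, e \in steps x s -> half_plane [:: f e.1; f e.2]) ->
  winding (fun p => - f p) x s =
    winding f x s (+) (upper (f x) (+) upper (f (last x s))).
Proof.
elim: s x => [|y s IH] x; first by rewrite /= addbb.
rewrite steps_cons => h /=; rewrite IH => [|e he]; last first.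
  by apply: h; rewrite inE he orbT.
rewrite ray_crossing_opp; last by apply: (h (x, y)); rewrite mem_head.
by case: (ray_crossing _ _) (winding f y s) (upper (f y)) (upper (f x)) (upper (f (last _ _)))
  => [] [] [] [] [].
Qed.

Lemma addb_glue a b c x x' t t' :
  a (+) b = x (+) x' -> b (+) c = t (+) t' ->
  a (+) c = (x (+) t) (+) (x' (+) t').
Proof. by case: a b c x x' t t' => [] [] [] [] [] [] []. Qed.

(** The relations of the cells of the grid add up to a relation on its
boundary, because the inner sides occur twice. *)
Lemma winding_square (A B : eqType) (F : A -> B -> K * K) x s y t :
  (forall e e', e \in steps x s -> e' \in steps y t ->
     half_plane [:: F e.1 e'.1; F e.2 e'.1; F e.1 e'.2; F e.2 e'.2]) ->
  winding (F^~ y) x s (+) winding (F^~ (last y t)) x s =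
  winding (F x) y t (+) winding (F (last x s)) y t.
Proof.
elim: t y => [|y' t IH] y; first by rewrite /= !addbb.
rewrite steps_cons => h /=.
have {}IH := IH y' (fun e e' he he' => h e e' he (@mem_behead _ (_ :: _) _ he')).
have strip : winding (F^~ y) x s (+) winding (F^~ y') x s =
             ray_crossing (F x y) (F x y') (+) ray_crossing (F (last x s) y) (F (last x s) y').
  have {IH} : forall e, e \in steps x s ->
      half_plane [:: F e.1 y; F e.2 y; F e.1 y'; F e.2 y'].
    by move=> e he; apply: (h e (y, y')) => //; rewrite mem_head.
  clear h; elim: s x => [|x' s IHs] x; first by rewrite /= addbb.
  rewrite steps_cons => h /=.
  have {}IHs := IHs x' (fun e he => h e (@mem_behead _ (_ :: _) _ he)).
  have sq := ray_crossing_square (h (x, x') (mem_head _ _)).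
  by apply/esym/addb_glue; apply/esym; [exact: sq|exact: IHs].
exact: addb_glue strip IH.
Qed.

(** Of the four sides of the boundary only the one in the right half-plane
meets the positive axis, and its ends are on different sides of the axis: the
winding number is odd, in contradiction with [winding_square]. *)
Lemma poincare_miranda (A B : eqType) (F : A -> B -> K * K) x s y t :
  (forall e e', e \in steps x s -> e' \in steps y t ->
     half_plane [:: F e.1 e'.1; F e.2 e'.1; F e.1 e'.2; F e.2 e'.2]) ->
  (forall q, q \in y :: t -> (F x q).1 < 0 /\ 0 < (F (last x s) q).1) ->
  (forall p, p \in x :: s -> 0 < (F p y).2 /\ (F p (last y t)).2 < 0) ->
  False.
Proof.
move=> /winding_square + hx hy.
rewrite (@winding_side _ (fun u => 0 < u.2)); first last.
- by move=> p /hy[].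
- by move=> u v hu hv; rewrite ray_crossing_same // /upper hu hv.
rewrite (@winding_side _ (fun u => u.2 < 0)); first last.
- by move=> p /hy[].
- by move=> u v hu hv; rewrite ray_crossing_same // /upper; apply/idP/idP; lra.
rewrite (@winding_side _ (fun u => u.1 < 0) (F x)); first last.
- by move=> p /hx[].
- move=> u v hu hv.
  have H (a b : K * K) : a.1 < 0 -> b.1 < 0 -> upper a -> upper b = false ->
      (0 < cross a b) && ~~ (cross a b < 0).
    move=> a1 b1 /upper_ge0[a2 a2'] /lower_le0[b2 _].
    have {a2' a2} a2 : 0 < a.2.
      rewrite lt_neqAle a2 andbT eq_sym.
      by apply: contraTneq a1 => /a2'; rewrite -leNgt => /ltW.
    suff c : 0 < cross a b by rewrite c lt_gtF.
    rewrite /cross subr_gt0 (@lt_le_trans _ _ 0) ?pmulr_rlt0 //.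
    by rewrite mulr_le0 // ltW.
  rewrite /ray_crossing; case ux: (upper u); case uy: (upper v) => //=.
    by case/andP: (H _ _ hu hv ux uy) => _ /negPf.
  by move: (H _ _ hv hu uy ux); rewrite /cross => h; apply/negbTE; lra.
rewrite winding_right => [|q /hx[] //].
have -> : upper (F (last x s) y) by rewrite /upper (hy _ (mem_last _ _)).1.
suff -> : upper (F (last x s) (last y t)) = false by [].
have [_] := hy _ (mem_last x s); rewrite /upper => h.
by apply/negbTE; lra.
Qed.

End Winding.

Lemma half_plane_linear (K : realType) (a b c d : K) (s : seq (K * K)) :
  a * d - b * c != 0 -> half_plane s ->
  half_plane [seq (a * u.1 + b * u.2, c * u.1 + d * u.2) | u <- s].
Proof.
move=> det [l hl]; exists ((l.1 * d - l.2 * c) / (a * d - b * c),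
  (l.2 * a - l.1 * b) / (a * d - b * c)).
rewrite all_map; apply: sub_all hl => u /=.
by rewrite (_ : _ + _ = l.1 * u.1 + l.2 * u.2) //; field.
Qed.

Section Metric.
Variable K : realType.
Implicit Types p q u : K * K.

Definition close_by (d : K) p q : bool :=
  (`|p.1 - q.1| <= d) && (`|p.2 - q.2| <= d).

Definition far (d : K) u : bool := (d <= `|u.1|) || (d <= `|u.2|).

(** The coordinate of p - q of size at least e varies by at most 2d < e over
the cell, and so keeps its sign. *)
Lemma half_plane_cell d e p p' q q' : close_by d p p' -> close_by d q q' ->
  far e (p - q) -> d *+ 2 < e ->
  half_plane [:: p - q; p' - q; p - q'; p' - q'].
Proof.
case: p p' q q' => [p1 p2] [p1' p2'] [q1 q2] [q1' q2'].
rewrite /close_by /far /= !ler_distl => /andP[/andP[? ?] /andP[? ?]].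
move=> /andP[/andP[? ?] /andP[? ?]] hf de; case/orP: hf.
  case: (lerP 0 (p1 - q1)) => h; rewrite ?(ger0_norm h) ?(ltr0_norm h) => hf.
    by exists (1, 0); rewrite /= !mul1r !mul0r !addr0; apply/and5P; split; lra.
  exists (-1, 0); rewrite /= !mulN1r !mul0r !addr0; apply/and5P; split; lra.
case: (lerP 0 (p2 - q2)) => h; rewrite ?(ger0_norm h) ?(ltr0_norm h) => hf.
  by exists (0, 1); rewrite /= !mul1r !mul0r !add0r; apply/and5P; split; lra.
exists (0, -1); rewrite /= !mulN1r !mul0r !add0r; apply/and5P; split; lra.
Qed.

End Metric.

(** * The complete graph on five vertices in an annulus *)

Section IntegerParity.
Implicit Types f g : int -> bool.

(** A sum over the integers restricted to a window, for functions that are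
constant near each end of the window. *)
Definition parity (B : nat) f : bool :=
  \big[addb/false]_(k < B.*2.+1) f (k%:Z - B%:Z).

Lemma eq_parity B f g : f =1 g -> parity B f = parity B g.
Proof. by move=> fg; apply: eq_bigr => k _; rewrite fg. Qed.

Lemma parityD B f g :
  parity B (fun z => f z (+) g z) = parity B f (+) parity B g.
Proof. by rewrite /parity big_split. Qed.

Lemma parityN B f : parity B (fun z => f (- z)) = parity B f.
Proof.
rewrite /parity (reindex_inj rev_ord_inj) /=; apply: eq_bigr => k _.
by congr f; have := ltn_ord k; lia.
Qed.

Lemma parity_neg B f : parity B (fun z => ~~ f z) = ~~ parity B f.
Proof.
rewrite -[RHS]addTb -(eq_parity _ (fun z => addTb (f z))) parityD; congr addb.
rewrite /parity (eq_bigr (fun=> true)) // big_const_ord.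
elim: B => [//|B IH]; by rewrite doubleS 2!iterS IH.
Qed.

(** Each shift by one drops the value at one end of the window and adds the
value at the other end. *)
Lemma parity_shift1 B f :
  parity B (fun z => f (z + 1)) = parity B f (+) (f (- B%:Z) (+) f (B%:Z + 1)).
Proof.
rewrite /parity big_ord_recr [X in _ = X (+) _]big_ord_recl /=.
have -> : f (B.*2%:Z - B%:Z + 1) = f (B%:Z + 1) by congr f; lia.
have -> : f (0%:Z - B%:Z) = f (- B%:Z) by congr f; lia.
rewrite [X in _ = _ (+) X (+) _](eq_bigr (fun k : 'I__ => f (k%:Z - B%:Z + 1))).
  by move: (bigop _ _ _) (f _) (f _) => [] [] [].
by move=> k _; congr f; rewrite /bump /=; lia.
Qed.

Lemma parity_shift B (B0 : nat) f (lo hi : bool) (n : int) :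
  (forall z, z <= - B0%:Z -> f z = lo) -> (forall z, B0%:Z <= z -> f z = hi) ->
  (B0 + (`|n|%N).*2 <= B)%N ->
  parity B (fun z => f (z + n)) = parity B f (+) (odd `|n|%N && (lo (+) hi)).
Proof.
have pos (m b0 : nat) g : (forall z, z <= - b0%:Z -> g z = lo) ->
    (forall z, b0%:Z <= z -> g z = hi) -> (b0 + m <= B)%N ->
    parity B (fun z => g (z + m%:Z)) = parity B g (+) (odd m && (lo (+) hi)).
  move=> glo ghi; elim: m => [|m IH] bB.
    by rewrite addbF; apply: eq_parity => z; rewrite addr0.
  rewrite (eq_parity _ (g := fun z => g ((z + 1) + m%:Z))); last first.
    by move=> z; congr g; lia.
  rewrite (parity_shift1 B (fun z => g (z + m%:Z))) IH; last by lia.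
  rewrite glo; last by lia.
  rewrite ghi; last by lia.
  by rewrite /=; case: (odd m) (lo (+) hi) (parity B g) => [] [] [].
move=> flo fhi; case: n => m /= mB; first by apply: (pos m B0) => //; lia.
have := pos m.+1 (B0 + m.+1)%N (fun z => f (z + Negz m)).
rewrite (eq_parity _ (g := f)) => [->|z]; last by congr f; lia.
- by rewrite -addbA addbb addbF.
- by move=> z zB; apply: flo; lia.
- by move=> z zB; apply: fhi; lia.
- by lia.
Qed.

End IntegerParity.

(** The relations for the fifteen pairs of independent edges of K5 are
incompatible.  In their sum each n c a b occurs twice, once for each vertex that
can be joined to c by an edge independent of ab, so that the left-hand side is
0.  The right-hand side is 1: reversing one arc ab of the tournament changes six
of the relations, and for a transitive tournament each of the five sets of four
vertices contributes 1, as for the diagonals of a convex pentagon. *)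
Lemma tournament_parity (up : nat -> nat -> bool) (n : nat -> nat -> nat -> bool) :
  (forall a b, (a < b < 5)%N -> up b a = ~~ up a b) ->
  (forall a b c d, (a < b < 5)%N -> (c < d < 5)%N -> uniq [:: a; b; c; d] ->
     n c a b (+) n d a b (+) n a c d (+) n b c d =
     up a c (+) up b c (+) up a d (+) up b d) -> False.
Proof.
move=> anti rel.
have xorE a b : a (+) b = xorb a b by case: a b => [] [].
have sum2 (a b c d : bool) : a = b -> c = d -> xorb a c = xorb b d.
  by move=> -> ->.
have h1 := sum2 _ _ _ _ (rel 0 1 2 3 isT isT isT) (rel 0 2 1 3 isT isT isT).
have h2 := sum2 _ _ _ _ h1 (rel 0 3 1 2 isT isT isT).
have h3 := sum2 _ _ _ _ h2 (rel 0 1 2 4 isT isT isT).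
have h4 := sum2 _ _ _ _ h3 (rel 0 2 1 4 isT isT isT).
have h5 := sum2 _ _ _ _ h4 (rel 0 4 1 2 isT isT isT).
have h6 := sum2 _ _ _ _ h5 (rel 0 1 3 4 isT isT isT).
have h7 := sum2 _ _ _ _ h6 (rel 0 3 1 4 isT isT isT).
have h8 := sum2 _ _ _ _ h7 (rel 0 4 1 3 isT isT isT).
have h9 := sum2 _ _ _ _ h8 (rel 0 2 3 4 isT isT isT).
have h10 := sum2 _ _ _ _ h9 (rel 0 3 2 4 isT isT isT).
have h11 := sum2 _ _ _ _ h10 (rel 0 4 2 3 isT isT isT).
have h12 := sum2 _ _ _ _ h11 (rel 1 2 3 4 isT isT isT).
have h13 := sum2 _ _ _ _ h12 (rel 1 3 2 4 isT isT isT).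
have := sum2 _ _ _ _ h13 (rel 1 4 2 3 isT isT isT).
rewrite ?(anti 1 2) ?(anti 1 3) ?(anti 1 4) ?(anti 2 3) ?(anti 2 4) ?(anti 3 4) //.
rewrite !xorE => {h1 h2 h3 h4 h5 h6 h7 h8 h9 h10 h11 h12 h13}.
match goal with |- ?l = ?r -> _ =>
  have -> : l = false by btauto
end.
match goal with |- _ = ?r -> _ => have -> : r = true by btauto end.
by [].
Qed.

Lemma nat_bound (K : realType) (s : seq K) :
  exists B : nat, forall x, x \in s -> `|x| <= B%:R.
Proof.
elim: s => [|y s [B hB]]; first by exists 0%N.
exists (maxn B (Num.truncn `|y|).+1) => x; rewrite inE => /orP[/eqP->|/hB].
  by rewrite (le_trans (ltW (truncnS_gt _))) // ler_nat leq_maxr.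
by move=> /le_trans; apply; rewrite ler_nat leq_maxl.
Qed.

(** A drawing of K5 on the annulus obtained from the plane by identifying
points that differ by a vertical integer vector up z.  The vertex a is lifted to
v a, and E a b lists the points that follow v a on a lift of the edge ab; this
lift ends n a b turns away from v b. *)
Section Annulus.
Variables (K : realType) (v : nat -> K * K) (E : nat -> nat -> seq (K * K)).
Variable n : nat -> nat -> int.

Let up (z : int) : K * K := (0, z%:~R).

Hypothesis E_end : forall a b, (a < b < 5)%N ->
  last (v a) (E a b) = v b + up (n a b).
Hypothesis E_cell : forall a b c d, (a < b < 5)%N -> (c < d < 5)%N ->
  uniq [:: a; b; c; d] ->
  forall e e', e \in steps (v a) (E a b) -> e' \in steps (v c) (E c d) ->
  forall z, half_plane [:: e.1 - e'.1 - up z; e.2 - e'.1 - up z;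
                           e.1 - e'.2 - up z; e.2 - e'.2 - up z].
Hypothesis E_vertex : forall a b c, (a < b < 5)%N -> (c < 5)%N ->
  uniq [:: a; b; c] -> forall e, e \in steps (v a) (E a b) ->
  forall z, half_plane [:: e.1 - v c - up z; e.2 - v c - up z].
Hypothesis v_neq : forall a b, (a < b < 5)%N ->
  forall z, v a - v b - up z != 0.

Let points : seq (K * K) :=
  flatten [seq v a :: flatten [seq E a b | b <- iota 0 5] | a <- iota 0 5].

Let v_point a : (a < 5)%N -> v a \in points.
Proof.
move=> a5; apply/flattenP; exists (v a :: flatten [seq E a b | b <- iota 0 5]).
  by apply/mapP; exists a; rewrite ?mem_iota.
exact: mem_head.
Qed.

Let E_point a b p : (a < b < 5)%N -> p \in v a :: E a b -> p \in points.
Proof.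
move=> /andP[ab b5]; have a5 := ltn_trans ab b5.
rewrite inE => /orP[/eqP->|pE]; first exact: v_point.
apply/flattenP; exists (v a :: flatten [seq E a b | b <- iota 0 5]).
  by apply/mapP; exists a; rewrite ?mem_iota.
rewrite inE; apply/orP; right; apply/flattenP; exists (E a b) => //.
by apply/mapP; exists b; rewrite ?mem_iota.
Qed.

(** For independent edges ab and cd, [winding_square] is applied to the
differences of the points of the two edges, and the resulting relations are
summed over all vertical integer translations.  The sides of the square are the
paths p - v c and p - v d for p on ab, and v a - q and v b - q for q on cd.  By
[ray_crossing_opp] the first two may be reversed at the price of the sides of the axis
on which their ends lie.  The number of turns of ab enters this price once for c
and once for d, and so disappears modulo 2.  What is left are the relations
refuted by [tournament_parity]. *)
Lemma no_K5_annulus : False.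
Proof.
have [C hC] := nat_bound [seq p.2 | p <- points].
have {}hC p : p \in points -> `|p.2| <= C%:R.
  by move=> pp; apply: hC; apply: map_f.
(* Differences of points and numbers of turns are all below B0.  The window
   must remain wide enough after a translation by a number of turns. *)
pose B0 := (C.*2.+1)%N; pose B := (B0 + B0.*2)%N.
have hn a b : (a < b < 5)%N -> (`|n a b| <= B0)%N.
  move=> ab; have := hC _ (E_point ab (mem_last _ _)).
  have /hC : v b \in points by apply: v_point; case/andP: ab.
  rewrite E_end //= !ler_norml => /andP[h1 h2] /andP[h3 h4].
  have : `|(n a b)%:~R| <= C.*2%:R :> K.
    by rewrite -addnn natrD ler_norml; apply/andP; split; lra.
  rewrite -intr_norm -[C.*2%:R]/(C.*2%:Z%:~R) ler_int.
  by rewrite /B0; lia.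
have hi p q (z : int) : p \in points -> q \in points -> B0%:Z <= z ->
    (p - q - up z).2 < 0.
  move=> /hC + /hC; rewrite !ler_norml /= => /andP[h1 h2] /andP[h3 h4].
  rewrite -(ler_int K) /B0 -[C.*2.+1%:~R]/(C.*2.+1%:R) -addn1 -addnn !natrD.
  by lra.
have lo p q (z : int) : p \in points -> q \in points -> z <= - B0%:Z ->
    0 < (p - q - up z).2.
  move=> /hC + /hC; rewrite !ler_norml /= => /andP[h1 h2] /andP[h3 h4].
  rewrite -(ler_int K) /B0 intrN -[C.*2.+1%:~R]/(C.*2.+1%:R) -addn1 -addnn !natrD.
  by lra.
pose M x a b := parity B (fun z => winding (fun p => p - v x - up z) (v a) (E a b)).
pose N x a b := parity B (fun z => winding (fun p => v x - p - up z) (v a) (E a b)).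
pose eta a x := parity B (fun z => upper (v a - v x - up z)).
have upD z w : up (z + w) = up z + up w by apply: injective_projections; rewrite /= ?addr0 ?intrD.
have upN z : up (- z) = - up z by apply: injective_projections; rewrite /= ?oppr0 ?intrN.
have side (P : pred (K * K)) : P = (fun u => 0 < u.2) \/ P = (fun u => u.2 < 0) ->
    forall u w, P u -> P w -> ray_crossing u w = false.
  case=> -> u w hu hw; rewrite ray_crossing_same // /upper ?hu ?hw //.
  by apply/idP/idP; lra.
have winding_far f x s : (forall p, p \in x :: s -> p \in points) ->
    (forall p, p \in x :: s -> exists p1 p2, [/\ p1 \in points, p2 \in points &
       f p = p1 - p2]) ->
    forall z, B0%:Z <= `|z| -> winding (fun p => f p - up z) x s = false.
  move=> hs hf z hz; have [z0|z0] := lerP 0 z.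
    apply: (@winding_side _ _ (fun u => u.2 < 0)); first by apply: side; right.
    by move=> p /hf[p1 [p2 [h1 h2 ->]]]; apply: hi => //; lia.
  apply: (@winding_side _ _ (fun u => 0 < u.2)); first by apply: side; left.
  by move=> p /hf[p1 [p2 [h1 h2 ->]]]; apply: lo => //; lia.
have shift0 f x s m : (forall p, p \in x :: s -> p \in points) ->
    (forall p, p \in x :: s -> exists p1 p2, [/\ p1 \in points, p2 \in points &
       f p = p1 - p2]) -> (`|m| <= B0)%N ->
    parity B (fun z => winding (fun p => f p - up (z + m)) x s) =
    parity B (fun z => winding (fun p => f p - up z) x s).
  move=> hs hf hm.
  rewrite (@parity_shift B B0 (fun z => winding (fun p => f p - up z) x s)
    false false) ?andbF ?addbF //.
  - by move=> z hz; apply: winding_far => //; lia.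
  - by move=> z hz; apply: winding_far => //; lia.
  - by rewrite /B; lia.
have MN x a b : (a < b < 5)%N -> (x < 5)%N -> uniq [:: a; b; x] ->
    M x a b = N x a b (+) (eta a x (+) eta b x (+) odd `|n a b|%N).
  move=> ab x5 abx; have b5 : (b < 5)%N by case/andP: ab.
  have -> : N x a b = parity B (fun z => winding (fun p => p - v x - up z) (v a) (E a b)
      (+) (upper (v a - v x - up z) (+) upper (v b - v x - up (z - n a b)))).
    rewrite -[LHS]parityN; apply: eq_parity => z.
    rewrite [LHS](@eq_winding _ _ _ (fun p => - (p - v x - up z))); last first.
      by move=> p; rewrite upN !opprB opprK addrC.
    rewrite winding_opp => [|e /E_vertex]; last exact.
    congr (_ (+) (_ (+) upper _)).
    by rewrite E_end // upD upN opprB addrA (addrAC (v b)).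
  rewrite !parityD -/(M x a b) -/(eta a x).
  rewrite (@parity_shift B B0 (fun z => upper (v b - v x - up z)) true false).
  - rewrite -/(eta b x) abszN andbT.
    by case: (M _ _ _) (eta _ _) (eta _ _) (odd _) => [] [] [] [].
  - by move=> z hz; rewrite /upper lo // v_point.
  - move=> z hz; have h : (v b - v x - up z).2 < 0 by apply: hi => //; apply: v_point.
    by rewrite /upper; apply/negbTE; lra.
  - by rewrite /B abszN; have := hn _ _ ab; lia.
apply: (@tournament_parity eta N) => [a b ab|a b c d ab cd abcd].
  have b5 : (b < 5)%N by case/andP: ab.
  have a5 : (a < 5)%N by case/andP: ab => ab _; apply: ltn_trans b5.
  rewrite -parity_neg -[LHS]parityN; apply: eq_parity => z.
  rewrite -upperN ?v_neq // upN opprK !opprB.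
  by congr upper; rewrite addrC.
have ha p : p \in v a :: E a b -> p \in points by apply: E_point.
have hc p : p \in v c :: E c d -> p \in points by apply: E_point.
have [b5 d5] : (b < 5)%N /\ (d < 5)%N by case/andP: ab; case/andP: cd.
have [a5 c5] : (a < 5)%N /\ (c < 5)%N by lia.
have hsq : M c a b (+) M d a b = N a c d (+) N b c d.
  have -> : M d a b = parity B (fun z =>
      winding (fun p => p - last (v c) (E c d) - up z) (v a) (E a b)).
    rewrite /M -(@shift0 (fun p => p - v d) _ _ (n c d)) ?hn //; last first.
      by move=> p /ha hp; exists p, (v d); rewrite v_point.
    apply: eq_parity => z; apply: eq_winding => p.
    by rewrite E_end // upD (addrC (up z)) !opprD !addrA.
  have -> : N b c d = parity B (fun z =>
      winding (fun q => last (v a) (E a b) - q - up z) (v c) (E c d)).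
    rewrite /N -(@shift0 (fun q => v b - q) _ _ (- n a b)) ?abszN ?hn //; last first.
      by move=> p /hc hp; exists (v b), p; rewrite v_point.
    apply: eq_parity => z; apply: eq_winding => p.
    by rewrite E_end // upD upN opprB addrA (addrAC (v b)).
  rewrite /M /N -!parityD; apply: eq_parity => z.
  apply: (@winding_square _ _ _ (fun p q => p - q - up z)) => e e' he he'.
  exact: E_cell ab cd abcd _ _ he he' z.
move: hsq; rewrite !MN //.
  move=> hsq; rewrite -addbA -{}hsq.
  move: (N c a b) (N d a b) (eta a c) (eta b c) (eta a d) (eta b d) (odd _).
  by do 7! case.
all: by move: abcd; rewrite /= !inE; lia.
Qed.

End Annulus.

(** * Closed curves and complete graphs on the torus *)

Section TorusDrawings.
Variable K : realType.
Implicit Types p q u : K * K.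

Definition lattice (z : int * int) : K * K := (z.1%:~R, z.2%:~R).

Definition wedge (w z : int * int) : int := w.1 * z.2 - w.2 * z.1.

Lemma latticeD z w : lattice (z + w) = lattice z + lattice w.
Proof. by apply: injective_projections; rewrite /= intrD. Qed.

Lemma latticeN z : lattice (- z) = - lattice z.
Proof. by apply: injective_projections; rewrite /= intrN. Qed.

Lemma latticeB z w : lattice (z - w) = lattice z - lattice w.
Proof. by rewrite latticeD latticeN. Qed.

Lemma lattice0 : lattice 0 = 0.
Proof. by apply: injective_projections. Qed.

Lemma close_byD d p q u : close_by d (p + u) (q + u) = close_by d p q.
Proof.
have shift (a b c : K) : a + c - (b + c) = a - b by ring.
by rewrite /close_by /= !shift.
Qed.

Lemma close_by_sym d p q : close_by d p q = close_by d q p.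
Proof. by rewrite /close_by distrC [X in _ && (X <= _)]distrC. Qed.

Lemma path_shift d x s u :
  path (close_by d) (x + u) [seq p + u | p <- s] = path (close_by d) x s.
Proof. by apply: (@mono_path _ _ (fun p => p + u)) => p q; apply: close_byD. Qed.

Fixpoint repeat_loop (h : K * K) (s : seq (K * K)) (m : nat) : seq (K * K) :=
  if m is m'.+1 then s ++ [seq p + h | p <- repeat_loop h s m'] else [::].

Section RepeatLoop.
Variables (d : K) (h x : K * K) (s : seq (K * K)).
Hypotheses (s_end : last x s = x + h) (s_path : path (close_by d) x s).

Lemma repeat_loop_end m : last x (repeat_loop h s m) = x + h *+ m.
Proof.
elim: m => [|m IH] /=; first by rewrite mulr0n addr0.
by rewrite last_cat s_end (last_map (fun p => p + h)) IH -addrA -mulrSr.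
Qed.

Lemma repeat_loop_path m : path (close_by d) x (repeat_loop h s m).
Proof. by elim: m => //= m IH; rewrite cat_path s_path s_end path_shift. Qed.

Lemma repeat_loop_mem m p : p \in x :: repeat_loop h s m ->
  exists p0 k, p0 \in x :: s /\ p = p0 + h *+ k.
Proof.
elim: m p => [|m IH] p /=.
  by rewrite inE => /eqP->; exists x, 0%N; rewrite mem_head mulr0n addr0.
rewrite -cat_cons mem_cat => /orP[ps|/mapP[q qr ->]].
  by exists p, 0%N; rewrite ps mulr0n addr0.
have [|p0 [k [p0s ->]]] := IH q; first by rewrite inE qr orbT.
by exists p0, k.+1; rewrite p0s -addrA -mulrSr.
Qed.

End RepeatLoop.

(** The lists are lifts to the plane of two closed curves on the torus with
homology classes tau and sigma.  Follow each curve 2M times.  In the basis formed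
by tau and sigma, the difference of the two lifts is, up to a bounded error, the
affine map (i, j) |-> (i - M, M - j), so that for M large it satisfies the sign
conditions of [poincare_miranda] while it stays away from 0. *)
Lemma far_loops_parallel (d e : K) x s (tau : int * int) y t (sigma : int * int) :
  last x s = x + lattice tau -> path (close_by d) x s ->
  last y t = y + lattice sigma -> path (close_by d) y t ->
  d *+ 2 < e ->
  (forall p q z, p \in x :: s -> q \in y :: t -> far e (p - q - lattice z)) ->
  wedge tau sigma = 0.
Proof.
move=> xe xp ye yp de xy; apply/eqP/negP => /negP D0.
have [h hE] : exists h, h = lattice tau by exists (lattice tau).
have [k kE] : exists k, k = lattice sigma by exists (lattice sigma).
rewrite -hE in xe; rewrite -kE in ye.
pose D : K := (wedge tau sigma)%:~R.
have DE : D = h.1 * k.2 - h.2 * k.1 by rewrite hE kE /D /wedge intrB !intrM.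
have D1 : 1 <= D * D.
  rewrite -intrM ler1z; case: (ltgtP (wedge tau sigma) 0) D0 => // hD _.
    by rewrite -[1]mulr1 -[_ * wedge _ _]mulrNN; apply: ler_pM; lia.
  by rewrite -[1]mulr1; apply: ler_pM; lia.
have [C hC] := nat_bound ([seq D * ((p - q).1 * k.2 - (p - q).2 * k.1) |
    p <- x :: s, q <- y :: t] ++ [seq D * (h.1 * (p - q).2 - h.2 * (p - q).1) |
    p <- x :: s, q <- y :: t]).
have hC1 p q : p \in x :: s -> q \in y :: t ->
    `|D * ((p - q).1 * k.2 - (p - q).2 * k.1)| <= C%:R.
  by move=> px qy; apply: hC; rewrite mem_cat; apply/orP; left;
     apply/allpairsP; exists (p, q).
have hC2 p q : p \in x :: s -> q \in y :: t ->
    `|D * (h.1 * (p - q).2 - h.2 * (p - q).1)| <= C%:R.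
  by move=> px qy; apply: hC; rewrite mem_cat; apply/orP; right;
     apply/allpairsP; exists (p, q).
(* Since D is a nonzero integer, M * D^2 exceeds the bounded error C. *)
pose M := C.+1.
have MD : C%:R < M%:R * (D * D).
  by rewrite (@lt_le_trans _ _ M%:R) ?ltr_nat // ler_peMr ?ler0n.
(* F is D^2 times the coordinates of the translated difference in the basis
   (h, k); the factor D^2, rather than D, makes its orientation irrelevant. *)
pose F p q : K * K := let u := p - q - (h *+ M - k *+ M) in
  (D * k.2 * u.1 + - (D * k.1) * u.2, - (D * h.2) * u.1 + D * h.1 * u.2).
have fstM (u : K * K) m : (u *+ m).1 = m%:R * u.1.
  by elim: m => [|m IH]; rewrite ?mulr0n ?mul0r // mulrS /= IH -natr1; ring.
have sndM (u : K * K) m : (u *+ m).2 = m%:R * u.2.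
  by elim: m => [|m IH]; rewrite ?mulr0n ?mul0r // mulrS /= IH -natr1; ring.
have F1 p q (i j : nat) : (F (p + h *+ i) (q + k *+ j)).1 =
    D * ((p - q).1 * k.2 - (p - q).2 * k.1) + (i%:R - M%:R) * (D * D).
  rewrite /F /= !fstM !sndM; move: DE; move: (D) h.1 h.2 k.1 k.2 i%:R j%:R M%:R.
  by move=> ? ? ? ? ? ? ? ? ->; ring.
have F2 p q (i j : nat) : (F (p + h *+ i) (q + k *+ j)).2 =
    D * (h.1 * (p - q).2 - h.2 * (p - q).1) + (M%:R - j%:R) * (D * D).
  rewrite /F /= !fstM !sndM; move: DE; move: (D) h.1 h.2 k.1 k.2 i%:R j%:R M%:R.
  by move=> ? ? ? ? ? ? ? ? ->; ring.
apply: (@poincare_miranda _ _ _ F x (repeat_loop h s (M + M)) y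
  (repeat_loop k t (M + M))).
- move=> a b ha hb.
  have ca := path_steps (repeat_loop_path xe xp _) ha.
  have cb := path_steps (repeat_loop_path ye yp _) hb.
  have [a1 _] := andP (mem_steps ha); have [b1 _] := andP (mem_steps hb).
  have [p0 [i [p0x ae]]] := repeat_loop_mem a1.
  have [q0 [j [q0y be]]] := repeat_loop_mem b1.
  pose c := h *+ M - k *+ M.
  have cb' : close_by d (b.1 + c) (b.2 + c) by rewrite close_byD.
  have hfar : far e (a.1 - (b.1 + c)).
    have -> : a.1 - (b.1 + c) = p0 - q0 - lattice (sigma *+ j - tau *+ i + (tau *+ M - sigma *+ M)).
      have latM z m : lattice (z *+ m) = lattice z *+ m.
        by elim: m => [|m IH]; rewrite ?mulr0n ?lattice0 // !mulrS latticeD IH.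
      rewrite !(latticeD, latticeN, latM) -hE -kE ae be /c !opprD !opprK !addrA.
      by congr (_ + _ + _); rewrite (addrAC p0) addrAC.
    exact: xy.
  have := half_plane_cell ca cb' hfar de; move=> /(@half_plane_linear _ (D * k.2)
     (- (D * k.1)) (- (D * h.2)) (D * h.1)).
  have subE u w : u - (w + c) = u - w - c by rewrite opprD addrA.
  rewrite !subE [map _ _]/=; apply.
  rewrite (_ : _ - _ = D * (D * (h.1 * k.2 - h.2 * k.1))); last by ring.
  rewrite -DE.
  by rewrite !mulf_eq0 !orbb intr_eq0.
- move=> q /repeat_loop_mem [q0 [j [q0y ->]]]; rewrite (repeat_loop_end xe).
  have := hC1 _ _ (mem_head x s) q0y.
  have F0 := F1 x q0 0%N j; rewrite mulr0n addr0 in F0; rewrite F0 F1.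
  by rewrite natrD ler_norml => /andP[? ?]; split; lra.
- move=> p /repeat_loop_mem [p0 [i [p0x ->]]]; rewrite (repeat_loop_end ye).
  have := hC2 _ _ p0x (mem_head y t).
  have F0 := F2 p0 y i 0%N; rewrite mulr0n addr0 in F0; rewrite F0 F2.
  by rewrite natrD ler_norml => /andP[? ?]; split; lra.
Qed.

End TorusDrawings.

Section TorusK5.
Variable K : realType.
Implicit Types p q u : K * K.

(** A drawing of K5 on the torus, lifted edge by edge to the plane; the lift
of ab ends at the translate of v b by h a b.  In the last clause the pairs (a, a)
stand for vertices. *)
Definition torus_drawing (d e : K) (v : nat -> K * K)
    (E : nat -> nat -> seq (K * K)) (h : nat -> nat -> int * int) : Prop :=
  [/\ forall a b, (a < b < 5)%N -> last (v a) (E a b) = v b + lattice K (h a b),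
      forall a b, (a < b < 5)%N -> path (close_by d) (v a) (E a b)
    & forall a b c f, (a <= b < 5)%N -> (c <= f < 5)%N ->
        a != c -> a != f -> b != c -> b != f ->
        forall p q z, p \in v a :: E a b -> q \in v c :: E c f ->
        far e (p - q - lattice K z)].

(** Vertices are lifted again along the edges from the vertex 0.  The edge ab
then ends off its second vertex by the homology class of the triangle 0ab. *)
Definition base_shift (h : nat -> nat -> int * int) (a : nat) : int * int :=
  if a is 0%N then 0 else h 0%N a.

Definition triangle_class (h : nat -> nat -> int * int) (a b : nat) :=
  base_shift h a + h a b - base_shift h b.

Lemma steps_map (A B : Type) (f : A -> B) x s :
  steps (f x) (map f s) = [seq (f e.1, f e.2) | e <- steps x s].
Proof. by elim: s x => //= y s IH x; rewrite !steps_cons IH. Qed.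

Lemma torus_drawing_triangle d e v E h : torus_drawing d e v E h ->
  forall a b, (a < b < 5)%N -> exists s,
  [/\ last (v 0%N) s = v 0%N + lattice K (triangle_class h a b),
      path (close_by d) (v 0%N) s
    & forall p, p \in v 0%N :: s -> exists i j p0 z,
      [/\ (i < j < 5)%N, p0 \in v i :: E i j & p = p0 + lattice K z]].
Proof.
move=> [Eend Epath _] [|a] b ab.
  exists [::]; split=> //=; first by rewrite /triangle_class add0r;
    case: b ab => // b _; rewrite subrr lattice0 addr0.
  by move=> p; rewrite inE => /eqP->; exists 0%N, 1%N, (v 0%N), 0;
    rewrite mem_head lattice0 addr0.
have [a5 b5] : (0 < a.+1 < 5)%N /\ (0 < b < 5)%N by lia.
set t := triangle_class h a.+1 b.
have tE : t = h 0%N a.+1 + h a.+1 b - h 0%N b.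
  by rewrite /t /triangle_class; case: (b) b5.
pose back := rev (belast (v 0%N) (E 0%N b)).
exists (E 0%N a.+1 ++ [seq p + lattice K (h 0%N a.+1) | p <- E a.+1 b] ++
        [seq p + lattice K t | p <- back]).
have e1 : last (v 0%N) (E 0%N a.+1) = v a.+1 + lattice K (h 0%N a.+1).
  exact: Eend.
have e2 : last (v a.+1 + lattice K (h 0%N a.+1))
    [seq p + lattice K (h 0%N a.+1) | p <- E a.+1 b] =
    last (v 0%N) (E 0%N b) + lattice K t.
  rewrite (last_map (fun p => p + _)) !Eend // tE latticeB latticeD.
  by rewrite addrACA subrr addr0 addrA addrAC.
split.
- rewrite !last_cat e1 e2 (last_map (fun p => p + _)) /back; congr (_ + _).
  by case: (E 0%N b) => //= y s; rewrite rev_cons last_rcons.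
- rewrite !cat_path e1 e2 !path_shift !Epath //=.
  rewrite /back rev_path (eq_path (e' := close_by d)) ?Epath // => p q.
  exact: close_by_sym.
- move=> p; rewrite -cat_cons !mem_cat => /or3P[p1|/mapP[q q1 ->]|/mapP[q q1 ->]].
  + by exists 0%N, a.+1, p, 0; rewrite p1 lattice0 addr0.
  + by exists a.+1, b, q, (h 0%N a.+1); rewrite inE q1 orbT.
  + exists 0%N, b, q, t; split => //.
    by rewrite /back mem_rev in q1; apply: mem_belast q1.
Qed.

(** All triangle classes are integer multiples of the primitive vector
(w1, w2) on the line of w.  A linear map L with determinant -1 sends this vector
to (0, 1); in the new coordinates the drawing lives on the annulus that covers
the torus and has (w1, w2) as its period, where [no_K5_annulus] applies. *)
Lemma no_K5_torus_parallel (d e : K) v E h (w : int * int) :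
  0 <= d -> d *+ 2 < e -> torus_drawing d e v E h -> w != 0 ->
  (forall a b, (a < b < 5)%N -> wedge w (triangle_class h a b) = 0) -> False.
Proof.
move=> d0 de [Eend Epath Efar] w0 wpar.
have [r [s [t [w1 [w2 [g0 bez]]]]]] : exists r s g w1 w2 : int,
    g != 0 /\ [/\ w.1 = w1 * g, w.2 = w2 * g & r * w1 + s * w2 = 1].
  have [r [s rs]] := Bezoutz w.1 w.2; set g := gcdz w.1 w.2 in rs.
  have g0 : g != 0.
    by rewrite gcdz_eq0; move: w0; rewrite -pair_eqE.
  exists r, s, g, (w.1 %/ g)%Z, (w.2 %/ g)%Z; split=> //.
  have e1 : w.1 = (w.1 %/ g)%Z * g by rewrite divzK ?dvdz_gcdl.
  have e2 : w.2 = (w.2 %/ g)%Z * g by rewrite divzK ?dvdz_gcdr.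
  split=> //; apply: (mulIf g0); rewrite mul1r -{}[RHS]rs.
  by rewrite mulrDl -!mulrA -e1 -e2.
case: bez => e1 e2 bez.
have wpar' a b : (a < b < 5)%N ->
    w1 * (triangle_class h a b).2 = w2 * (triangle_class h a b).1.
  move=> /wpar; rewrite /wedge e1 e2 => eq0; apply: (mulIf g0).
  by apply/eqP; rewrite -subr_eq0 -[X in _ == X]eq0; apply/eqP; ring.
pose n a b := r * (triangle_class h a b).1 + s * (triangle_class h a b).2.
have tauE a b : (a < b < 5)%N ->
    triangle_class h a b = (n a b * w1, n a b * w2).
  move=> ab; have := wpar' a b ab; rewrite /n.
  move: (triangle_class h a b) => [x y] /= xy; congr pair.
    transitivity (r * x * w1 + s * (w1 * y)); last by ring.
    by rewrite xy -[LHS]mul1r -bez; ring.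
  transitivity (r * (w2 * x) + s * y * w2); last by ring.
  by rewrite -xy -[LHS]mul1r -bez; ring.
pose L u : K * K := (- w2%:~R * u.1 + w1%:~R * u.2, r%:~R * u.1 + s%:~R * u.2).
have bezK : r%:~R * w1%:~R + s%:~R * w2%:~R = 1 :> K.
  by rewrite -!intrM -intrD bez.
have detL : - w2%:~R * s%:~R - w1%:~R * r%:~R != 0 :> K.
  by rewrite (_ : _ - _ = -1) ?oppr_eq0 ?oner_eq0 //; lra.
have LD p q : L (p + q) = L p + L q.
  by apply: injective_projections; rewrite /=; ring.
have LN p : L (- p) = - L p.
  by apply: injective_projections; rewrite /=; ring.
have Llat (z : int) : L (lattice K (z * w1, z * w2)) = (0, z%:~R).
  apply: injective_projections; rewrite /= !intrM; first by ring.
  transitivity (z%:~R * (r%:~R * w1%:~R + s%:~R * w2%:~R) : K); first by ring.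
  by rewrite bezK mulr1.
pose S a : K * K := lattice K (base_shift h a).
have cell a b c f p p' q q' (z : int) : (a <= b < 5)%N -> (c <= f < 5)%N ->
    uniq [:: a; c] && uniq [:: a; f] && uniq [:: b; c] && uniq [:: b; f] ->
    close_by d p p' -> close_by d q q' -> p \in v a :: E a b -> q \in v c :: E c f ->
    half_plane [:: L (p + S a) - L (q + S c) - (0, z%:~R);
                   L (p' + S a) - L (q + S c) - (0, z%:~R);
                   L (p + S a) - L (q' + S c) - (0, z%:~R);
                   L (p' + S a) - L (q' + S c) - (0, z%:~R)].
  rewrite /= !inE !andbT => ab cf /andP[/andP[/andP[ac af] bc] bf] pp qq hp hq.
  have [y hy] : exists y, forall p q,
    L (p + S a) - L (q + S c) - (0, z%:~R) = L (p - (q + lattice K y)).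
    exists (base_shift h c - base_shift h a + (z * w1, z * w2)) => p1 q1.
    rewrite -Llat -!LN -!LD; congr L.
    rewrite !(latticeD, latticeN) -/(S a) -/(S c).
    rewrite !opprD opprK !addrA; congr (_ - _).
    by rewrite [RHS]addrAC; congr (_ + _); rewrite addrAC.
  rewrite !hy; have qq' : close_by d (q + lattice K y) (q' + lattice K y).
    by rewrite close_byD.
  have hf : far e (p - (q + lattice K y)).
    by rewrite opprD addrA; apply: (Efar a b c f).
  exact: half_plane_linear detL (half_plane_cell pp qq' hf de).
have nighxx p : close_by d p p by rewrite /close_by !subrr normr0 d0.
apply: (@no_K5_annulus K (fun a => L (v a + S a))
  (fun a b => [seq L (p + S a) | p <- E a b]) n).
- move=> a b ab; rewrite (last_map (fun p => L (p + S a))) Eend // -Llat -tauE // -LD.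
  congr L; rewrite /triangle_class latticeB latticeD -/(S a) -/(S b).
  by rewrite [RHS]addrACA subrr addr0 (addrC (S a)) addrA.
- move=> a b c f ab cf abcf e1' e2' /=.
  rewrite !(steps_map (fun p => L (p + S _))) => /mapP[e3 h3 ->] /mapP[e4 h4 ->] z.
  apply: (@cell a b c f).
  + by case/andP: ab => /ltnW->.
  + by case/andP: cf => /ltnW->.
  + by move: abcf; rewrite /= !inE; lia.
  + exact: path_steps (Epath _ _ ab) h3.
  + exact: path_steps (Epath _ _ cf) h4.
  + by case/andP: (mem_steps h3).
  + by case/andP: (mem_steps h4).
- move=> a b c ab c5 abc e1' /=.
  rewrite (steps_map (fun p => L (p + S _))) => /mapP[e3 h3 ->] z /=.
  have := @cell a b c c e3.1 e3.2 (v c) (v c) z.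
  case/andP: (ab) => /ltnW -> ->; rewrite leqnn c5 mem_head nighxx.
  rewrite (path_steps (Epath _ _ ab) h3); case/andP: (mem_steps h3) => -> _.
  move=> /(_ isT isT _ isT isT isT isT) hc; apply: half_plane_sub (hc _) => [u|].
    by rewrite !inE => /orP[]->; rewrite ?orbT.
  by move: abc; rewrite /= !inE; lia.
- move=> a b ab z; have [a5 b5] : (a < 5)%N /\ (b < 5)%N by lia.
  have := @cell a a b b (v a) (v a) (v b) (v b) z.
  rewrite !leqnn a5 b5 !mem_head !nighxx /= !inE !andbT.
  have -> : (a != b) = true by lia.
  move=> /(_ isT isT isT isT isT isT isT) [l /allP/(_ _ (mem_head _ _))].
  rewrite -[X in X != 0]/(L (v a + S a) - L (v b + S b) - (0, z%:~R)).
  by apply: contraTneq => ->; rewrite /= !mulr0 addr0 ltxx.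
Qed.

(** If a triangle of the first copy has a nonzero class, the classes of the
triangles of the second copy are parallel to it; otherwise those of the first
copy are all 0, hence parallel to any vector. *)
Lemma no_two_K5_torus (d e : K) v E h v' E' h' : 0 <= d -> d *+ 2 < e ->
  torus_drawing d e v E h -> torus_drawing d e v' E' h' ->
  (forall a b a' b' p q z, (a < b < 5)%N -> (a' < b' < 5)%N ->
    p \in v a :: E a b -> q \in v' a' :: E' a' b' ->
    far e (p - q - lattice K z)) -> False.
Proof.
move=> d0 de D D' DD'.
have par a b a' b' : (a < b < 5)%N -> (a' < b' < 5)%N ->
    wedge (triangle_class h a b) (triangle_class h' a' b') = 0.
  move=> ab ab'; have [s [se sp sm]] := torus_drawing_triangle D ab.
  have [t [te tp tm]] := torus_drawing_triangle D' ab'.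
  apply: (far_loops_parallel se sp te tp de) => p q z.
  move=> /sm[i [j [p0 [y [ij hp ->]]]]] /tm[i' [j' [q0 [y' [ij' hq ->]]]]].
  have := DD' _ _ _ _ _ _ (y' - y + z) ij ij' hp hq.
  rewrite !(latticeD, latticeN) !opprD opprK !addrA.
  by rewrite (addrAC p0 (lattice K y)) (addrAC _ (lattice K y) (- lattice K y')).
have [[[a b] ab]|no] := pselect (exists2 ab : nat * nat,
    (ab.1 < ab.2 < 5)%N & triangle_class h ab.1 ab.2 != 0).
  move=> /= t0; apply: (no_K5_torus_parallel d0 de D' t0) => a' b' ab'.
  exact: par.
apply: (@no_K5_torus_parallel d e v E h (1, 0) d0 de D) => // a b ab.
have [->|t0] := eqVneq (triangle_class h a b) 0; first by rewrite /wedge mulr0 mul0r subrr.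
by case: no; exists (a, b).
Qed.

End TorusK5.

(** * A piecewise linear angle *)

Section Diamond.
Variable K : realType.
Implicit Types p q : K * K.

Definition on_diamond p : bool := `|p.1| + `|p.2| == 1.

(** The radial projection to the unit circle of the norm |x| + |y|. *)
Definition diamond p : K * K :=
  (p.1 / (`|p.1| + `|p.2|), p.2 / (`|p.1| + `|p.2|)).

(** Arc length along this circle divided by its total length, so that the
period is 1.  It replaces the argument of a complex number by a function within
the reach of linear arithmetic; its values are in ]-1/2, 1/2]. *)
Definition angle p : K :=
  if 0 <= p.2 then (1 - p.1) / 4 else - ((1 - p.1) / 4).

Lemma diamond_gt0 p : p != 0 -> 0 < `|p.1| + `|p.2|.
Proof.
case: p => x y; rewrite -pair_eqE /= negb_and => h.
rewrite lt_neqAle addr_ge0 // andbT eq_sym paddr_eq0 // !normr_eq0.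
by rewrite negb_and.
Qed.

Lemma on_diamondP p : p != 0 -> on_diamond (diamond p).
Proof.
move=> /diamond_gt0 p0; rewrite /on_diamond /= !normrM normfV.
by rewrite (ger0_norm (ltW p0)) -mulrDl divff // gt_eqF.
Qed.

Lemma angle_close_by d p q : d < 1/2 -> on_diamond p -> on_diamond q ->
  close_by d p q -> exists z : int, `|angle p - angle q - z%:~R| <= d.
Proof.
case: p q => [p1 p2] [q1 q2]; rewrite /on_diamond /close_by /angle /=.
move=> d2 /eqP hp /eqP hq; rewrite !ler_distl => /andP[/andP[? ?] /andP[? ?]].
have [z hz] : exists z : int, z%:~R - d <=
    (if 0 <= p2 then (1 - p1) / 4 else - ((1 - p1) / 4)) -
    (if 0 <= q2 then (1 - q1) / 4 else - ((1 - q1) / 4)) <= z%:~R + d.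
  have hp' := hp; have hq' := hq; move: hp hq.
  have [pp|pp] := lerP 0 p1; have [qq|qq] := lerP 0 q1;
  have [pp2|pp2] := lerP 0 p2; have [qq2|qq2] := lerP 0 q2;
  rewrite ?(ger0_norm pp) ?(ltr0_norm pp) ?(ger0_norm qq) ?(ltr0_norm qq)
    ?(ger0_norm pp2) ?(ltr0_norm pp2) ?(ger0_norm qq2) ?(ltr0_norm qq2) => hp hq;
  first [by exists 0; rewrite mulr0z; apply/andP; split; lra
        | by exists 1; rewrite mulr1z; apply/andP; split; lra
        | by exists (-1); rewrite mulrN1z; apply/andP; split; lra].
by exists z; rewrite ler_distl.
Qed.

(** On the circle the coordinates are 4-Lipschitz functions of the angle
modulo 1. *)
Lemma angle_far d p q (z : int) : on_diamond p -> on_diamond q ->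
  `|angle p - angle q - z%:~R| <= d -> close_by (4 * d) p q.
Proof.
case: p q => [p1 p2] [q1 q2]; rewrite /on_diamond /close_by /angle /=.
move=> /eqP hp /eqP hq; rewrite ler_distl => /andP[lo hi].
have [z2|z2] : (`|z| <= 1)%N \/ 1 <= d.
  have [|z2] := leqP `|z| 1; first by left.
  right; have {z2} : 2 <= `|z|%:~R :> K by rewrite -[2]/(2%:Z%:~R) ler_int; lia.
  have n1 : 0 <= `|p1| /\ 0 <= `|p2| by rewrite !normr_ge0.
  have n2 : 0 <= `|q1| /\ 0 <= `|q2| by rewrite !normr_ge0.
  have b1 : -1 <= p1 <= 1 by rewrite -ler_norml; lra.
  have b2 : -1 <= q1 <= 1 by rewrite -ler_norml; lra.
  rewrite intr_norm; move: lo hi; case: ifP => _; case: ifP => _; 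
  by case: (ger0P (z%:~R : K)) => _; lra.
- have : z = 0 \/ z = 1 \/ z = -1 by lia.
  move: hp hq lo hi; rewrite !ler_norml.
  have [pp|pp] := lerP 0 p1; have [qq|qq] := lerP 0 q1;
  have [pp2|pp2] := lerP 0 p2; have [qq2|qq2] := lerP 0 q2;
  rewrite ?(ger0_norm pp) ?(ltr0_norm pp) ?(ger0_norm qq) ?(ltr0_norm qq)
    ?(ger0_norm pp2) ?(ltr0_norm pp2) ?(ger0_norm qq2) ?(ltr0_norm qq2) => hp hq lo hi;
  move=> [z0|[z0|z0]]; rewrite z0 ?mulr0z ?mulr1z ?mulrN1z in lo hi;
  by apply/andP; split; apply/andP; split; lra.
- have n1 : 0 <= `|p1| /\ 0 <= `|p2| by rewrite !normr_ge0.
  have n2 : 0 <= `|q1| /\ 0 <= `|q2| by rewrite !normr_ge0.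
  rewrite !(le_trans (ler_normB _ _)) //; lra.
Qed.

Definition torus_coord (P : (K * K) * (K * K)) : K * K := (angle P.1, angle P.2).

Definition on_torus (P : (K * K) * (K * K)) : bool :=
  on_diamond P.1 && on_diamond P.2.

Definition close_by2 (d : K) (P Q : (K * K) * (K * K)) : bool :=
  close_by d P.1 Q.1 && close_by d P.2 Q.2.

Lemma torus_coord_far d P Q z : on_torus P -> on_torus Q ->
  ~~ close_by2 (4 * d) P Q -> far d (torus_coord P - torus_coord Q - lattice K z).
Proof.
move=> /andP[P1 P2] /andP[Q1 Q2]; apply: contraR.
rewrite /far negb_or -!ltNge => /andP[/ltW h1 /ltW h2].
by rewrite /close_by2 (angle_far P1 Q1 h1) (angle_far P2 Q2 h2).
Qed.

(** Path lifting: the integer vector attached to each new point is the one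
that makes the step small. *)
Lemma torus_path_lift d x s x' z0 : d < 1/2 -> all on_torus (x :: s) ->
  path (close_by2 d) x s -> x' = torus_coord x + lattice K z0 ->
  exists s' h, [/\ last x' s' = torus_coord (last x s) + lattice K h,
    path (close_by d) x' s'
    & forall p', p' \in x' :: s' -> exists P z,
        P \in x :: s /\ p' = torus_coord P + lattice K z].
Proof.
move=> d2; elim: s x x' z0 => [|y s IH] x x' z0 /=.
  move=> _ _ x'E; exists [::], z0; split=> // p'.
  by rewrite inE => /eqP->; exists x, z0; rewrite mem_head.
move=> /and3P[Tx Ty Ts] /andP[/andP[xy1 xy2] ys] x'E.
have [[x1 x2] [y1 y2]] := (andP Tx, andP Ty).
have [z1 h1] := angle_close_by d2 x1 y1 xy1.
have [z2 h2] := angle_close_by d2 x2 y2 xy2.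
pose y' := torus_coord y + lattice K ((z1, z2) + z0).
have [|s' [h [sl sp sm]]] := IH y y' _ _ ys erefl; first by rewrite /= Ty.
exists (y' :: s'), h; split=> //=.
- rewrite sp andbT x'E /y' latticeD addrA close_byD /close_by /=.
  by rewrite !opprD !addrA h1 h2.
- move=> p'; rewrite inE => /orP[/eqP->|/sm[p [z [ps ->]]]].
    by exists x, z0; rewrite mem_head.
  by exists p, z; rewrite inE ps orbT.
Qed.

End Diamond.

Local Open Scope classical_set_scope.

(** * From arcs to finite sequences *)

(** By continuity, the supremum of the times that small steps can reach is
reached, and exceeded when it is less than 1. *)
Lemma fine_subdivision (K : realType) (M : pseudoMetricType K) (f : K -> M)
    (e : K) : 0 < e -> {within `[0, 1], continuous f} ->
  exists ts : seq K, [/\ last 0 ts = 1, all (fun t => 0 <= t <= 1) (0 :: ts)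
    & path (fun s t => `[< ball (f s) e (f t) >]) 0 ts].
Proof.
move=> e0 /subspace_continuousP fc.
pose good x (ts : seq K) := [/\ last 0 ts = x,
  all (fun t => 0 <= t <= 1) (0 :: ts)
  & path (fun s t => `[< ball (f s) e (f t) >]) 0 ts].
pose A : set K := [set x | exists ts, good x ts].
have A01 x : A x -> 0 <= x <= 1.
  by case=> ts [<- /allP + _]; apply; apply: mem_last.
have A0 : A 0 by exists [::]; rewrite /good /= lexx ler01.
have hA : has_sup A by split; [exists 0 | exists 1 => x /A01/andP[]].
have S0 : 0 <= sup A by apply: sup_upper_bound hA _ A0.
have S1 : sup A <= 1 by apply: ge_sup; [exists 0 | move=> x /A01/andP[]].
have /fc/(_ _ (nbhsx_ballx _ _ (divr_gt0 e0 (ltr0n _ 2)))) : `[0, 1] (sup A).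
  by rewrite /= in_itv /= S0.
rewrite nbhs_simpl /= => /nbhs_ballP[d /= d0 hd].
have near_sup x : 0 <= x <= 1 -> `|sup A - x| < d -> ball (f (sup A)) (e / 2) (f x).
  by move=> x01 xd; apply: hd => /=; rewrite ?in_itv // -ball_normE.
have extend x : 0 <= x <= 1 -> `|sup A - x| < d -> A x.
  move=> x01 xd; have [a [ts [ta t01 tp]] ha] := sup_adherent d0 hA.
  have aS : a <= sup A by apply: sup_upper_bound hA _ _; exists ts.
  have a01 : 0 <= a <= 1 by apply: A01; exists ts.
  exists (rcons ts x); split; first by rewrite last_rcons.
    by rewrite -rcons_cons all_rcons x01.
  rewrite rcons_path tp ta /=; apply/asboolP.
  apply: (@ball_splitr _ _ (f (sup A))); last exact: near_sup.
  by apply: near_sup => //; rewrite ger0_norm ?subr_ge0 // ltrBlDl -ltrBlDr.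
suff : A 1 by [].
have [S1'|S1'] := ltP (sup A) 1; last first.
  have -> : 1 = sup A by apply/eqP; rewrite eq_le S1 S1'.
  by apply: extend; rewrite ?S0 // subrr normr0.
pose x := Num.min 1 (sup A + d / 2).
have Ax : A x.
  have h : sup A <= x <= sup A + d / 2.
    by rewrite /x ge_min le_min S1 lexx orbT /=; lra.
  apply: extend; first by rewrite /x ge_min lexx andbT le_min ler01 /=; lra.
  by rewrite ler0_norm; lra.
have := sup_upper_bound hA Ax; rewrite leNgt lt_min S1' /=.
by move/negP; case; lra.
Qed.

(** Disjoint compact sets lie at a positive distance. *)
Lemma disjoint_arcs_far (K : realType) (M : pseudoMetricType K) (f g : K -> M) :
  hausdorff_space M -> {within `[0, 1], continuous f} ->
  {within `[0, 1], continuous g} ->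
  (forall s t, 0 <= s <= 1 -> 0 <= t <= 1 -> f s <> g t) ->
  \forall e \near 0^'+, forall s t, 0 <= s <= 1 -> 0 <= t <= 1 ->
    ~ ball (f s) e (g t).
Proof.
rewrite ball_hausdorff => hM /subspace_continuousP fc /subspace_continuousP gc fg.
have cpt : compact (`[(0 : K), 1] `*` `[(0 : K), 1]).
  by apply: compact_setX; apply: segment_compact.
move/compact_near_coveringP/near_covering_withinP : cpt.
move=> cpt; pose P (e : K) (st : K * K) := ~ ball (f st.1) e (g st.2).
have cover x : (`[(0 : K), 1] `*` `[(0 : K), 1]) x ->
    \forall x' \near x & e \near 0^'+, (`[(0 : K), 1] `*` `[(0 : K), 1]) x' -> P e x'.
  case: x => [s t] /= [s01 t01].
  have [|[r r'] /= hr] := hM (f s) (g t).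
    by apply/eqP; apply: fg; move: s01 t01; rewrite /= !in_itv.
  have nf := fc _ s01 _ (nbhsx_ballx _ _ (divr_gt0 (gt0 r) (ltr0n _ 2))).
  have ng := gc _ t01 _ (nbhsx_ballx _ _ (gt0 r')).
  exists ([set x : K * K | (`[0, 1] x.1 -> ball (f s) (r%:num / 2) (f x.1)) /\
                           (`[0, 1] x.2 -> ball (g t) r'%:num (g x.2))],
          [set e : K | e <= r%:num / 2]) => /=.
    split; last by apply: nbhs_right_le.
    exists ([set x | `[0, 1] x -> ball (f s) (r%:num / 2) (f x)],
               [set x | `[0, 1] x -> ball (g t) r'%:num (g x)]); 
      first by (split; [exact: nf|exact: ng]).
    by move=> [a b] /= [].
  move=> [[s' t'] e] /= [[hf hg] he] [s'01 t'01] hb.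
  have : (ball (f s) r%:num `&` ball (g t) r'%:num) (g t').
    split; last exact: hg.
    by apply: (ball_split (hf s'01)); apply: le_ball hb.
  by move/eqP: hr => ->.
apply: filterS (cpt _ _ P _ cover) => e he s t s01 t01.
by apply: (he (s, t)); split; rewrite /= in_itv.
Qed.

(** Compactness gives e > 0 that separates the disjoint arcs and allows small
steps along each arc; the sequences obtained lift to the plane, where
[no_two_K5_torus] excludes them.  The arc from a to a is meant to be constant, so
that vertices are covered by the condition on disjoint arcs. *)
Lemma no_two_K5_arcs (K : realType)
    (pt : bool -> nat -> (K * K) * (K * K))
    (arc : bool -> nat -> nat -> K -> (K * K) * (K * K)) :
  (forall k a b, (a <= b < 5)%N -> {within `[0, 1], continuous (arc k a b)}) ->
  (forall k a b, (a <= b < 5)%N -> arc k a b 0 = pt k a /\ arc k a b 1 = pt k b) ->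
  (forall k a b t, (a <= b < 5)%N -> 0 <= t <= 1 -> on_torus (arc k a b t)) ->
  (forall k a b k' a' b' s t, (a <= b < 5)%N -> (a' <= b' < 5)%N ->
     (k = k' -> [&& a != a', a != b', b != a' & b != b']) ->
     0 <= s <= 1 -> 0 <= t <= 1 -> arc k a b s <> arc k' a' b' t) -> False.
Proof.
move=> arc_cont arc_ends arc_torus arc_disj.
pose I := ((bool * ('I_5 * 'I_5)) * (bool * ('I_5 * 'I_5)))%type.
have [e /= [e0 e1 efar]] : exists e : K, [/\ 0 < e, e <= 1 &
   forall i : I, let: ((k, (a, b)), (k', (a', b'))) := i in
     (a <= b)%N -> (a' <= b')%N ->
     (k = k' -> [&& a != a', a != b', b != a' & b != b']) ->
     forall s t, 0 <= s <= 1 -> 0 <= t <= 1 ->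
       ~ ball (arc k a b s) e (arc k' a' b' t)].
  suff : \forall e \near 0^'+, [/\ 0 < e, e <= (1 : K) & forall i : I,
     let: ((k, (a, b)), (k', (a', b'))) := i in
     (a <= b)%N -> (a' <= b')%N ->
     (k = k' -> [&& a != a', a != b', b != a' & b != b']) ->
     forall s t, 0 <= s <= 1 -> 0 <= t <= 1 ->
       ~ ball (arc k a b s) e (arc k' a' b' t)].
    by move=> /filter_ex[e he]; exists e.
  have : \forall e \near 0^'+, forall i : I,
     let: ((k, (a, b)), (k', (a', b'))) := i in
     (a <= b)%N -> (a' <= b')%N ->
     (k = k' -> [&& a != a', a != b', b != a' & b != b']) ->
     forall s t, 0 <= s <= 1 -> 0 <= t <= 1 ->
       ~ ball (arc k a b s) e (arc k' a' b' t).
    apply: filter_forall => -[[k [a b]] [k' [a' b']]].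
    have [[ab ab' dj]|no] := pselect [/\ (a <= b)%N, (a' <= b')%N &
        (k = k' -> [&& a != a', a != b', b != a' & b != b'])]; last first.
      by apply: filterE => e ab ab' dj; case: no.
    have ab5 : (a <= b < 5)%N by rewrite ab ltn_ord.
    have ab5' : (a' <= b' < 5)%N by rewrite ab' ltn_ord.
    have dj' s t := arc_disj k a b k' a' b' s t ab5 ab5' dj.
    apply: filterS (disjoint_arcs_far (@norm_hausdorff _ _)
      (arc_cont _ _ _ ab5) (arc_cont _ _ _ ab5') dj') => e he _ _ _.
    exact: he.
  apply: filterS3 (nbhs_right_gt 0) (nbhs_right_le ltr01) => e e0 e1 efar.
  by split.
(* Angles that differ by less than c belong to points at distance at most
   4c < e, and steps of size d satisfy 2d < c as well as d < 1/2. *)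
pose c := e / 8; pose d := c / 4.
have edge k a b : exists E h, (a <= b < 5)%N ->
    [/\ last (torus_coord (pt k a)) E = torus_coord (pt k b) + lattice K h,
        path (close_by d) (torus_coord (pt k a)) E
      & forall p, p \in torus_coord (pt k a) :: E -> exists t z, 0 <= t <= 1 /\
          p = torus_coord (arc k a b t) + lattice K z].
  have [ab|] := pselect (a <= b < 5)%N; last by exists [::], 0.
  have d0 : 0 < d by rewrite /d /c; lra.
  have [ts [tl t01 tp]] := fine_subdivision d0 (arc_cont k a b ab).
  have [x0 x1] := arc_ends k a b ab.
  have := @torus_path_lift K d (arc k a b 0) [seq arc k a b t | t <- ts]
    (torus_coord (pt k a)) 0.
  case=> [|||| E [h [El Ep Em]]].
  - by rewrite /d /c; lra.
  - rewrite -map_cons all_map; apply: sub_all t01 => t /=; exact: arc_torus.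
  - rewrite path_map; apply: sub_path tp => s t /= /asboolP.
    by move=> [[h1 h2] [h3 h4]]; rewrite -!ball_normE /= in h1 h2 h3 h4;
      rewrite /close_by2 /close_by !ltW.
  - by rewrite lattice0 addr0 x0.
  exists E, h => _; split=> //; first by rewrite El last_map tl x1.
  move=> p /Em[P [z [hP ->]]]; move: hP; rewrite -map_cons => /mapP[t ht ->].
  by exists t, z; split => //; apply: (allP t01).
have [E hE] := choice (fun kab : bool * nat * nat => edge kab.1.1 kab.1.2 kab.2).
have {hE} [h hE] := choice hE.
have farE k a b k' a' b' p q z : (a <= b < 5)%N -> (a' <= b' < 5)%N ->
    (k = k' -> [&& a != a', a != b', b != a' & b != b']) ->
    p \in torus_coord (pt k a) :: E (k, a, b) ->
    q \in torus_coord (pt k' a') :: E (k', a', b') -> far c (p - q - lattice K z).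
  move=> ab ab' dj.
  have [_ _ Em] := hE (k, a, b) ab; have [_ _ Em'] := hE (k', a', b') ab'.
  move=> /Em[s [y [s01 ->]]] /Em'[t [y' [t01 ->]]].
  have -> : torus_coord (arc k a b s) + lattice K y -
      (torus_coord (arc k' a' b' t) + lattice K y') - lattice K z =
      torus_coord (arc k a b s) - torus_coord (arc k' a' b' t) -
        lattice K (y' - y + z).
    by rewrite !(latticeD, latticeN) !opprD opprK !addrA
      (addrAC (torus_coord (arc k a b s))) (addrAC _ (lattice K y) (- lattice K y')).
  apply: torus_coord_far; rewrite ?arc_torus //; apply/negP => hn.
  have [b5 b5'] : (b < 5)%N /\ (b' < 5)%N by lia.
  have [a5 a5'] : (a < 5)%N /\ (a' < 5)%N by lia.
  apply: (efar ((k, (Ordinal a5, Ordinal b5)), (k', (Ordinal a5', Ordinal b5')))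
    _ _ dj s t s01 t01).
  - by case/andP: ab.
  - by case/andP: ab'.
  have ce : 4 * c < e by rewrite /c; lra.
  case/andP: hn => /andP[h1 h2] /andP[h3 h4].
  by split; split; rewrite /= -ball_normE /=; apply: le_lt_trans ce.
have drawing k : torus_drawing d c (fun a => torus_coord (pt k a))
    (fun a b => E (k, a, b)) (fun a b => h (k, a, b)).
  split=> [a b ab|a b ab|a b a' b' ab ab' n1 n2 n3 n4 p q z].
  - have ab' : (a <= b < 5)%N by case/andP: ab => /ltnW-> ->.
    by have [] := hE (k, a, b) ab'.
  - have ab' : (a <= b < 5)%N by case/andP: ab => /ltnW-> ->.
    by have [] := hE (k, a, b) ab'.
  - by apply: farE => // _; rewrite n1 n2 n3.
apply: (no_two_K5_torus _ _ (drawing true) (drawing false)).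
- by rewrite /d /c; lra.
- by rewrite /d /c mulr2n; lra.
- move=> a b a' b' p q z ab ab'; apply: farE => //.
    by case/andP: ab => /ltnW->.
  by case/andP: ab' => /ltnW->.
Qed.

(** * Coordinates on the sphere and on the torus *)

Lemma diamond_eq (K : realType) (p q : K * K) : p != 0 -> q != 0 ->
  diamond p = diamond q -> exists l, [/\ 0 < l, p.1 = l * q.1 & p.2 = l * q.2].
Proof.
move=> /diamond_gt0 p0 /diamond_gt0 q0; rewrite /diamond => -[e1 e2].
exists ((`|p.1| + `|p.2|) / (`|q.1| + `|q.2|)); split; first by rewrite divr_gt0.
  by rewrite -mulrA [_^-1 * _]mulrC -e1 mulrCA divff ?mulr1 // gt_eqF.
by rewrite -mulrA [_^-1 * _]mulrC -e2 mulrCA divff ?mulr1 // gt_eqF.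
Qed.

Lemma pair_continuous (T U V : topologicalType) (f : T -> U) (g : T -> V) x :
  {for x, continuous f} -> {for x, continuous g} ->
  {for x, continuous (fun y => (f y, g y))}.
Proof. by move=> fc gc; apply: cvg_pair. Qed.

Lemma diamond_continuous (K : realType) (T : topologicalType) (f g : T -> K) x :
  {for x, continuous f} -> {for x, continuous g} -> (f x, g x) != 0 ->
  {for x, continuous (fun y => diamond (f y, g y))}.
Proof.
move=> fc gc /diamond_gt0 /= n0.
have nc : {for x, continuous (fun y => (`|f y| + `|g y|)^-1)}.
  by apply: cvgV; [rewrite gt_eqF | apply: cvgD; apply: cvg_norm].
by apply: pair_continuous; apply: cvgM.
Qed.

Lemma torus_map_continuous (K : realType) (T : topologicalType)
    (f1 g1 f2 g2 : T -> K) x :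
  {for x, continuous f1} -> {for x, continuous g1} ->
  {for x, continuous f2} -> {for x, continuous g2} ->
  (f1 x, g1 x) != 0 -> (f2 x, g2 x) != 0 ->
  {for x, continuous (fun y => (diamond (f1 y, g1 y), diamond (f2 y, g2 y)))}.
Proof. by move=> ? ? ? ? ? ?; apply: pair_continuous; apply: diamond_continuous. Qed.

(** The copies of K5 are w true and w false.  The vertex u0 provides a point
p of the surface that both of them avoid, so that a continuous injection into
the torus is needed on the complement of p only. *)
Lemma no_embedding_of_two_K5 (K : realType) (X : topologicalType) (G : sgraph)
    (S : set X) (w : bool -> nat -> G) (u0 : G) :
  (forall k a k' a', (a < 5)%N -> (a' < 5)%N -> w k a = w k' a' ->
     k = k' /\ a = a') ->
  (forall k a b, (a < b < 5)%N -> adj (w k a) (w k b)) ->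
  (forall k a, (a < 5)%N -> w k a != u0) ->
  (forall p, S p -> exists J : X -> (K * K) * (K * K),
    [/\ forall x, S x -> x <> p -> {for x, continuous J},
        forall x, S x -> x <> p -> on_torus (J x)
      & forall x y, S x -> S y -> x <> p -> y <> p -> J x = J y -> x = y]) ->
  ~ embeds_in K G S.
Proof.
move=> w_inj w_adj w_u0 chart [pt [arc [pt_inj pt_S arcP arc_pt arc_arc]]].
have [J [J_cont J_torus J_inj]] := chart _ (pt_S u0).
pose g k a b t := if a == b then pt (w k a) else arc (w k a) (w k b) t.
have adjP k a b : (a <= b < 5)%N -> a != b -> adj (w k a) (w k b).
  by move=> ab nab; apply: w_adj; lia.
have gP k a b t : (a <= b < 5)%N -> 0 <= t <= 1 ->
    (exists2 c, (c == a) || (c == b) & g k a b t = pt (w k c)) \/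
    [/\ a != b, `]0, 1[ t & g k a b t = arc (w k a) (w k b) t].
  move=> ab t01; rewrite /g; case: eqVneq => [<-|nab].
    by left; exists a; rewrite ?eqxx.
  have [_ _ _ [a0 a1] _] := arcP _ _ (adjP k a b ab nab).
  have [->|t0] := eqVneq t 0; first by left; exists a; rewrite ?eqxx.
  have [->|t1] := eqVneq t 1; first by left; exists b; rewrite ?eqxx ?orbT.
  by right; split=> //=; rewrite in_itv /=; lra.
have gS k a b t : (a <= b < 5)%N -> 0 <= t <= 1 -> S (g k a b t).
  move=> ab t01; rewrite /g; case: eqVneq => [_|nab]; first exact: pt_S.
  have [_ _ sub _ _] := arcP _ _ (adjP k a b ab nab).
  by apply: sub; exists t => //=; rewrite in_itv.
have gu0 k a b t : (a <= b < 5)%N -> 0 <= t <= 1 -> g k a b t <> pt u0.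
  move=> ab t01; have [[c cab ->]|[nab t01' ->]] := gP k a b t ab t01.
    move/pt_inj/eqP; apply/negP; apply: w_u0.
    by case/orP: cab => /eqP->; lia.
  exact: arc_pt (adjP _ _ _ ab nab) t01'.
have gd k a b k' a' b' s t : (a <= b < 5)%N -> (a' <= b' < 5)%N ->
    (k = k' -> [&& a != a', a != b', b != a' & b != b']) ->
    0 <= s <= 1 -> 0 <= t <= 1 -> g k a b s <> g k' a' b' t.
  move=> ab ab' dj s01 t01.
  have [a5 b5] : (a < 5)%N /\ (b < 5)%N by lia.
  have [a5' b5'] : (a' < 5)%N /\ (b' < 5)%N by lia.
  have [[c cab ->]|[nab s01' ->]] := gP k a b s ab s01;
    have [[c' cab' ->]|[nab' t01' ->]] := gP k' a' b' t ab' t01.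
  - move/pt_inj/w_inj; case.
    + by case/orP: cab => /eqP->.
    + by case/orP: cab' => /eqP->.
    + move/dj/and4P => [n1 n2 n3 n4] cc.
      by move: cab cab' n1 n2 n3 n4; rewrite -cc; lia.
  - by move/esym; apply: arc_pt (adjP _ _ _ ab' nab') t01'.
  - by apply: arc_pt (adjP _ _ _ ab nab) s01'.
  - move=> /(arc_arc _ _ _ _ _ _ (adjP _ _ _ ab nab) (adjP _ _ _ ab' nab') s01' t01').
    case=> -[e _].
      have [kk aa] := w_inj _ _ _ _ a5 a5' e.
      by case/and4P: (dj kk) => /eqP n1; case: n1.
    have [kk aa] := w_inj _ _ _ _ a5 b5' e.
    by case/and4P: (dj kk) => _ /eqP n2; case: n2.
apply: (@no_two_K5_arcs K (fun k a => J (pt (w k a))) (fun k a b t => J (g k a b t))).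
- move=> k a b ab; apply: (@within_continuous_comp _ _ _ _ (g k a b) J).
    move=> x /set_mem[t /=]; rewrite in_itv /= => t01 <-.
    by apply: J_cont; [apply: gS|apply: gu0].
  rewrite /g; case: eqVneq => [_|nab].
    by apply: continuous_subspaceT => x; apply: cst_continuous.
  by have [] := arcP _ _ (adjP k a b ab nab).
- move=> k a b ab; rewrite /g; case: eqVneq => [<- //|nab].
  by have [_ _ _ [-> ->] _] := arcP _ _ (adjP k a b ab nab).
- by move=> k a b t ab t01; apply: J_torus; [apply: gS|apply: gu0].
- move=> k a b k' a' b' s t ab ab' dj s01 t01.
  move/J_inj => e; apply: (gd k a b k' a' b' s t ab ab' dj s01 t01).
  by apply: e; [apply: gS|apply: gS|apply: gu0|apply: gu0].
Qed.

Section Surfaces.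
Variable K : realType.

Lemma coordinate_continuous (x : K * K * K) :
  [/\ {for x, continuous (fun y : K * K * K => y.1.1)},
      {for x, continuous (fun y : K * K * K => y.1.2)}
    & {for x, continuous (fun y : K * K * K => y.2)}].
Proof.
have c1 : {for x, continuous (fst : K * K * K -> K * K)} by apply: cvg_fst.
have c2 : {for x, continuous (snd : K * K * K -> K)} by apply: cvg_snd.
have d1 : {for x.1, continuous (fst : K * K -> K)} by apply: cvg_fst.
have d2 : {for x.1, continuous (snd : K * K -> K)} by apply: cvg_snd.
by split; [exact: continuous_comp c1 d1|exact: continuous_comp c1 d2|exact: c2].
Qed.

Lemma diamond1_inj (u v : K) : diamond (u, 1) = diamond (v, 1) -> u = v.
Proof.
have n0 (t : K) : (t, 1) != 0 :> K * K by rewrite -pair_eqE /= oner_eq0 andbF.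
move=> /(diamond_eq (n0 _) (n0 _))[l /= [_ -> /esym]].
by rewrite mulr1 => ->; rewrite mul1r.
Qed.

Lemma sphere0P (x : K * K * K) : sphere_with_handles K 0 x ->
  x.1.1 ^+ 2 + x.1.2 ^+ 2 + x.2 ^+ 2 = 1.
Proof. by case: x => [[x y] z] /= [[]//|[_ []]]. Qed.

(** Stereographic projection from the point p of the sphere onto the plane of
the w with scalar product -1 with p. *)
Definition stereo (p x : K * K * K) : K * K * K :=
  let D := 1 - (x.1.1 * p.1.1 + x.1.2 * p.1.2 + x.2 * p.2) in
  ((x.1.1 - p.1.1) / D, (x.1.2 - p.1.2) / D, (x.2 - p.2) / D).

Lemma stereo_denominator p x : sphere_with_handles K 0 p ->
  sphere_with_handles K 0 x -> x <> p ->
  0 < 1 - (x.1.1 * p.1.1 + x.1.2 * p.1.2 + x.2 * p.2).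
Proof.
move=> /sphere0P hp /sphere0P hx; case: p x hp hx => [[a b] c] [[x y] z] /=.
move=> hp hx xp.
have e : (x - a) ^+ 2 + (y - b) ^+ 2 + (z - c) ^+ 2 =
    2 * (1 - (x * a + y * b + z * c)).
  transitivity ((x ^+ 2 + y ^+ 2 + z ^+ 2) + (a ^+ 2 + b ^+ 2 + c ^+ 2)
    - 2 * (x * a + y * b + z * c)); first by ring.
  by rewrite hp hx; ring.
have [x0 y0 z0] : [/\ 0 <= (x - a) ^+ 2, 0 <= (y - b) ^+ 2 & 0 <= (z - c) ^+ 2].
  by split; apply: sqr_ge0.
rewrite lt_neqAle; apply/andP; split; last by lra.
apply/eqP => D0; apply: xp; rewrite -D0 mulr0 in e.
have sq0 (u v : K) : (u - v) ^+ 2 = 0 -> u = v.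
  by move/eqP; rewrite sqrf_eq0 subr_eq0 => /eqP.
have xa : x = a by apply: sq0; lra.
have yb : y = b by apply: sq0; lra.
have zc : z = c by apply: sq0; lra.
by rewrite xa yb zc.
Qed.

Lemma stereo_plane p x : sphere_with_handles K 0 p ->
  sphere_with_handles K 0 x -> x <> p ->
  (stereo p x).1.1 * p.1.1 + (stereo p x).1.2 * p.1.2 + (stereo p x).2 * p.2 = -1.
Proof.
move=> hp hx xp; have D0 := stereo_denominator hp hx xp.
move/sphere0P: hp => hp; rewrite /stereo /=.
set D := 1 - _ in D0 *.
have e : (x.1.1 - p.1.1) * p.1.1 + (x.1.2 - p.1.2) * p.1.2 + (x.2 - p.2) * p.2 = - D.
  by rewrite /D -{1}hp; ring.
transitivity (- D / D); last by rewrite mulNr divff ?gt_eqF.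
by rewrite -e; ring.
Qed.

(** The squared norm of stereo p x is 2 / D, where D is its denominator, and
x = p + D (stereo p x). *)
Lemma stereo_inj p x y : sphere_with_handles K 0 p ->
  sphere_with_handles K 0 x -> sphere_with_handles K 0 y -> x <> p -> y <> p ->
  stereo p x = stereo p y -> x = y.
Proof.
move=> hp hx hy xp yp.
have := stereo_denominator hp hx xp; have := stereo_denominator hp hy yp.
move: hp hx hy => /sphere0P hp /sphere0P hx /sphere0P hy.
case: p x y hp hx hy {xp yp} => [[a b] c] [[x y] z] [[x' y'] z'] /=.
move=> hp hx hy; rewrite /stereo /=.
set D := 1 - (x * _ + _ + _); set D' := 1 - (x' * _ + _ + _) => D'0 D0 [e1 e2 e3].
have sqsum u v t E : u ^+ 2 + v ^+ 2 + t ^+ 2 = 1 -> 0 < E ->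
    E = 1 - (u * a + v * b + t * c) ->
    ((u - a) / E) ^+ 2 + ((v - b) / E) ^+ 2 + ((t - c) / E) ^+ 2 = 2 / E.
  move=> huvt E0 EE; have En : E != 0 by rewrite gt_eqF.
  transitivity (((u ^+ 2 + v ^+ 2 + t ^+ 2) + (a ^+ 2 + b ^+ 2 + c ^+ 2)
    - 2 * (u * a + v * b + t * c)) / E ^+ 2); first by field.
  have -> : u * a + v * b + t * c = 1 - E by rewrite EE; ring.
  by rewrite huvt hp; field.
have DD : D = D'.
  have := sqsum _ _ _ _ hx D0 erefl; rewrite e1 e2 e3 (sqsum _ _ _ _ hy D'0 erefl).
  move=> h; apply: invr_inj; apply: (mulfI (_ : 2 != 0)); last by rewrite h.
  by rewrite pnatr_eq0.
have Dn : D^-1 != 0 by rewrite invr_eq0 gt_eqF.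
move: e1 e2 e3; rewrite -DD.
by move=> /(mulIf Dn)/addIr-> /(mulIf Dn)/addIr-> /(mulIf Dn)/addIr->.
Qed.

Lemma stereo_continuous p x : sphere_with_handles K 0 p ->
  sphere_with_handles K 0 x -> x <> p ->
  [/\ {for x, continuous (fun y => (stereo p y).1.1)},
      {for x, continuous (fun y => (stereo p y).1.2)}
    & {for x, continuous (fun y => (stereo p y).2)}].
Proof.
move=> hp hx xp; have D0 := stereo_denominator hp hx xp.
have [c1 c2 c3] := coordinate_continuous x.
have cD : {for x, continuous (fun y : K * K * K =>
    (1 - (y.1.1 * p.1.1 + y.1.2 * p.1.2 + y.2 * p.2))^-1)}.
  apply: cvgV; first by rewrite gt_eqF.
  apply: cvgB; first exact: cvg_cst.
  by apply: cvgD; [apply: cvgD|]; apply: cvgM => //; apply: cvg_cst.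
by split; apply: cvgM => //; apply: cvgB => //; apply: cvg_cst.
Qed.

(** Two coordinates of stereo p x determine the third one when the
corresponding coordinate of p is not 0.  Each of the two reals u is then placed on
a circle by the direction of (u, 1). *)
Lemma punctured_sphere_chart p : sphere_with_handles K 0 p ->
  exists J : K * K * K -> (K * K) * (K * K),
  [/\ forall x, sphere_with_handles K 0 x -> x <> p -> {for x, continuous J},
      forall x, sphere_with_handles K 0 x -> x <> p -> on_torus (J x)
    & forall x y, sphere_with_handles K 0 x -> sphere_with_handles K 0 y ->
      x <> p -> y <> p -> J x = J y -> x = y].
Proof.
move=> hp.
have n0 (t : K) : (t, 1) != 0 :> K * K by rewrite -pair_eqE /= oner_eq0 andbF.
pose J (i j : K * K * K -> K) x : (K * K) * (K * K) :=
  (diamond (i (stereo p x), 1), diamond (j (stereo p x), 1)).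
have J_torus i j x : on_torus (J i j x).
  by rewrite /on_torus /J !on_diamondP.
have J_cont i j x : {for x, continuous (fun y => i (stereo p y))} ->
    {for x, continuous (fun y => j (stereo p y))} -> {for x, continuous (J i j)}.
  by move=> hi hj; apply: torus_map_continuous => //; apply: cvg_cst.
have J_inj i j x y : J i j x = J i j y ->
    i (stereo p x) = i (stereo p y) /\ j (stereo p x) = j (stereo p y).
  by rewrite /J => -[] *; split; apply: diamond1_inj; rewrite /diamond /=; congr pair.
have cancel (u v t : K) : t != 0 -> u * t = v * t -> u = v.
  by move=> t0; apply: mulIf.
have [[z0|y0]|x0] : (p.2 != 0 \/ p.1.2 != 0) \/ p.1.1 != 0.
  have [z0|] := eqVneq p.2 0; last by left; left.
  have [y0|] := eqVneq p.1.2 0; last by left; right.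
  have [x0|] := eqVneq p.1.1 0; last by right.
  by move/sphere0P: hp; rewrite x0 y0 z0 !expr0n /= !addr0 => /esym/eqP; rewrite oner_eq0.
- exists (J (fun w => w.1.1) (fun w => w.1.2)); split=> [x hx xp|//|x y hx hy xp yp].
    by have [? ? ?] := stereo_continuous hp hx xp; apply: J_cont.
  move/J_inj => -[e1 e2]; apply: (stereo_inj hp hx hy xp yp).
  have := stereo_plane hp hx xp; rewrite -(stereo_plane hp hy yp) e1 e2.
  move/addrI/(mulIf z0); move: e1 e2.
  by case: (stereo p x) (stereo p y) => [[? ?] ?] [[? ?] ?] /= -> -> ->.
- exists (J (fun w => w.1.1) (fun w => w.2)); split=> [x hx xp|//|x y hx hy xp yp].
    by have [? ? ?] := stereo_continuous hp hx xp; apply: J_cont.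
  move/J_inj => -[e1 e2]; apply: (stereo_inj hp hx hy xp yp).
  have := stereo_plane hp hx xp; rewrite -(stereo_plane hp hy yp) e1 e2.
  move/addIr/addrI/(mulIf y0); move: e1 e2.
  by case: (stereo p x) (stereo p y) => [[? ?] ?] [[? ?] ?] /= -> -> ->.
- exists (J (fun w => w.1.2) (fun w => w.2)); split=> [x hx xp|//|x y hx hy xp yp].
    by have [? ? ?] := stereo_continuous hp hx xp; apply: J_cont.
  move/J_inj => -[e1 e2]; apply: (stereo_inj hp hx hy xp yp).
  have := stereo_plane hp hx xp; rewrite -(stereo_plane hp hy yp) e1 e2.
  move/addIr/addIr/(mulIf x0); move: e1 e2.
  by case: (stereo p x) (stereo p y) => [[? ?] ?] [[? ?] ?] /= -> -> ->.
Qed.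

(** The tunnel is centered at the origin and has squared radius 1 / 64. *)
Lemma sphere1P (x : K * K * K) : sphere_with_handles K 1 x ->
  let r := x.1.1 ^+ 2 + x.1.2 ^+ 2 in
  (r + x.2 ^+ 2 = 1 /\ 1 / 64 <= r) \/ (r + x.2 ^+ 2 <= 1 /\ r = 1 / 64).
Proof.
have center0 : handle_center K 0 = 0 by rewrite /handle_center expr0 subrr.
have radius0 : handle_radius K 0 ^+ 2 = 1 / 64.
  by rewrite /handle_radius; field.
case: x => [[x y] z] /= [[h1 /(_ 0%N isT)]|[h1 [i]]].
  by rewrite radius0 /handle_dist2 center0 subr0; left.
by rewrite ltnS leqn0 => /eqP->; rewrite radius0 /handle_dist2 center0 subr0; right.
Qed.

(** The first angle is the longitude.  For the second one, in the half-plane of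
the squared distance r to the axis and of the height z, the surface is the
boundary of the convex region 1/64 <= r, r + z^2 <= 1, and each ray from its
interior point (1/2, 0) meets this boundary once. *)
Lemma torus_chart : exists J : K * K * K -> (K * K) * (K * K),
  [/\ forall x, sphere_with_handles K 1 x -> {for x, continuous J},
      forall x, sphere_with_handles K 1 x -> on_torus (J x)
    & forall x y, sphere_with_handles K 1 x -> sphere_with_handles K 1 y ->
      J x = J y -> x = y].
Proof.
pose r (x : K * K * K) := x.1.1 ^+ 2 + x.1.2 ^+ 2.
pose J x := (diamond (x.1.1, x.1.2), diamond (r x - 1 / 2, x.2)).
have xy_neq0 x : sphere_with_handles K 1 x -> (x.1.1, x.1.2) != 0.
  move=> /sphere1P; rewrite -/(r x) => h.
  have r0 : 0 < r x by case: h => -[]; lra.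
  apply: contraTneq r0 => -[e1 e2].
  by rewrite /r e1 e2 !expr0n /= addr0 ltxx.
have rz_neq0 x : sphere_with_handles K 1 x -> (r x - 1 / 2, x.2) != 0.
  move=> /sphere1P; rewrite -/(r x) => h; apply/eqP => -[e1 e2].
  by rewrite e2 expr0n /= in h; case: h => -[]; lra.
exists J; split=> [x hx|x hx|x y hx hy].
- have [c1 c2 c3] := coordinate_continuous x.
  apply: torus_map_continuous => //; [|exact: xy_neq0|exact: rz_neq0].
  by apply: cvgB; [apply: cvgD; apply: cvgM|apply: cvg_cst].
- by rewrite /on_torus /J !on_diamondP ?xy_neq0 ?rz_neq0.
(* A boundary point dilated from (1/2, 0) by a factor l > 1 is outside the
   region; a and c are relative to the abscissa 1/2. *)
have star (a b c d l : K) : 1 < l -> c = l * a -> d = l * b ->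
    (a + b ^+ 2 = 1 / 2 \/ a = 1 / 64 - 1 / 2) -> 1 / 64 - 1 / 2 <= c ->
    c + d ^+ 2 <= 1 / 2 -> False.
  move=> l1 -> -> [ab|->]; last by nra.
  move=> _; rewrite exprMn => h; have b0 := sqr_ge0 b.
  by nra.
move=> [e1 e2 e3 e4].
have [m [m0 /= m1 m2]] := diamond_eq (xy_neq0 x hx) (xy_neq0 y hy) (congr2 pair e1 e2).
have [l [l0 /= l1 l2]] := diamond_eq (rz_neq0 x hx) (rz_neq0 y hy) (congr2 pair e3 e4).
have lE : l = 1.
  move: hx hy => /sphere1P; rewrite -/(r x) => hx /sphere1P; rewrite -/(r y) => hy.
  case: (ltgtP l 1) => // hl; exfalso.
    apply: (@star (r x - 1 / 2) x.2 (r y - 1 / 2) y.2 l^-1).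
    - by rewrite invf_gt1.
    - by rewrite l1 mulKf // gt_eqF.
    - by rewrite l2 mulKf // gt_eqF.
    - by case: hx => -[? ?]; [left; lra|right; lra].
    - by case: hy => -[]; lra.
    - by case: hy => -[]; lra.
  apply: (@star (r y - 1 / 2) y.2 (r x - 1 / 2) x.2 l) => //.
  - by case: hy => -[? ?]; [left; lra|right; lra].
  - by case: hx => -[]; lra.
  - by case: hx => -[]; lra.
have rE : r x = r y by move: l1; rewrite lE; lra.
have mE : m = 1.
  have r0 : r y != 0.
    by move: hy => /sphere1P; rewrite -/(r y) => h; rewrite gt_eqF //; case: h => -[]; lra.
  have : m ^+ 2 * r y = r y by rewrite -{2}rE /r m1 m2; ring.
  move=> /eqP; rewrite -{2}[r y]mul1r => /eqP/(mulIf r0)/eqP.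
  by rewrite sqrf_eq1 => /orP[/eqP//|/eqP m'1]; move: m0; rewrite m'1; lra.
move: m1 m2 l2; rewrite mE lE !mul1r.
by case: x y {hx hy e1 e2 e3 e4 l1 rE} => [[? ?] ?] [[? ?] ?] /= -> -> ->.
Qed.

End Surfaces.

(** * Drawing three copies of K4 on the sphere *)

Section PlaneDrawing.
Variable K : realType.

(** A triangle and its centroid. *)
Definition K4_point (i : nat) : K * K :=
  match i with 0 => (0, 0) | 1 => (3, 0) | 2 => (0, 3) | _ => (1, 1) end.

Lemma K4_point_inj i j : (i < 4)%N -> (j < 4)%N -> K4_point i = K4_point j -> i = j.
Proof.
move: i j => [|[|[|[|//]]]] [|[|[|[|//]]]] //= _ _ [] *; exfalso; lra.
Qed.

Lemma K4_edge_vertex i j k (t : K) : (i < 4)%N -> (j < 4)%N -> (k < 4)%N ->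
  i <> j -> 0 < t < 1 ->
  (1 - t) * (K4_point i).1 + t * (K4_point j).1 = (K4_point k).1 ->
  (1 - t) * (K4_point i).2 + t * (K4_point j).2 = (K4_point k).2 -> False.
Proof.
move: i j k => [|[|[|[|//]]]] [|[|[|[|//]]]] [|[|[|[|//]]]] //= _ _ _ _; lra.
Qed.

Lemma K4_edge_edge i j i' j' (s t : K) : (i < 4)%N -> (j < 4)%N ->
  (i' < 4)%N -> (j' < 4)%N -> i <> j -> i' <> j' -> 0 < s < 1 -> 0 < t < 1 ->
  (1 - s) * (K4_point i).1 + s * (K4_point j).1 =
    (1 - t) * (K4_point i').1 + t * (K4_point j').1 ->
  (1 - s) * (K4_point i).2 + s * (K4_point j).2 =
    (1 - t) * (K4_point i').2 + t * (K4_point j').2 ->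
  (i = i' /\ j = j') \/ (i = j' /\ j = i').
Proof.
move: i j i' j' => [|[|[|[|//]]]] [|[|[|[|//]]]] [|[|[|[|//]]]] [|[|[|[|//]]]];
  move=> /= _ _ _ _ ni ni';
  first [by case: ni|by case: ni'|by move=> *; left|by move=> *; right
        |clear ni ni'; move=> *; exfalso; lra].
Qed.
End PlaneDrawing.

Section SphereDrawing.
Variable K : realType.

(** The inverse of the stereographic projection from the north pole. *)
Definition unstereo (p : K * K) : K * K * K :=
  let N := p.1 ^+ 2 + p.2 ^+ 2 + 1 in
  (2 * p.1 / N, 2 * p.2 / N, (p.1 ^+ 2 + p.2 ^+ 2 - 1) / N).

Lemma unstereo_gt0 (p : K * K) : 0 < p.1 ^+ 2 + p.2 ^+ 2 + 1.
Proof. by rewrite ltr_wpDl ?addr_ge0 ?sqr_ge0. Qed.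

Lemma unstereo_sphere p : sphere_with_handles K 0 (unstereo p).
Proof.
have N0 := unstereo_gt0 p; left; split=> //.
by case: p N0 => x y /= N0; field; rewrite gt_eqF.
Qed.

Lemma unstereo_inj : injective unstereo.
Proof.
move=> [x y] [x' y']; rewrite /unstereo /=.
have := unstereo_gt0 (x, y); have := unstereo_gt0 (x', y') => /=.
set N := x ^+ 2 + y ^+ 2 + 1; set N' := x' ^+ 2 + y' ^+ 2 + 1 => N'0 N0.
have zE (M : K) : 0 < M -> (M - 1 - 1) / M = 1 - 2 / M by move=> M0; field; rewrite gt_eqF.
rewrite -[x ^+ 2 + y ^+ 2](addrK 1) -[x' ^+ 2 + y' ^+ 2](addrK 1) -/N -/N'.
rewrite !zE // => -[e1 e2 /addrI/oppr_inj e3].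
have n2 : 2 != 0 :> K by rewrite pnatr_eq0.
have NN : N = N' by apply: invr_inj; apply: (mulfI n2).
have Nn : N^-1 != 0 by rewrite invr_eq0 gt_eqF.
move: e1 e2; rewrite -NN.
by move=> /(mulIf Nn)/(mulfI n2)-> /(mulIf Nn)/(mulfI n2)->.
Qed.

Lemma unstereo_continuous (T : topologicalType) (f g : T -> K) :
  continuous f -> continuous g -> continuous (fun t => unstereo (f t, g t)).
Proof.
move=> fc gc t.
have f2 : {for t, continuous (fun y => f y ^+ 2)} by apply: cvgM; apply: fc.
have g2 : {for t, continuous (fun y => g y ^+ 2)} by apply: cvgM; apply: gc.
have Nc : {for t, continuous (fun y => (f y ^+ 2 + g y ^+ 2 + 1)^-1)}.
  apply: cvgV; first by rewrite gt_eqF // (unstereo_gt0 (f t, g t)).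
  by apply: cvgD; [apply: cvgD|apply: cvg_cst].
have xc : {for t, continuous (fun y => 2 * f y / (f y ^+ 2 + g y ^+ 2 + 1))}.
  by apply: cvgM => //; apply: cvgM; [apply: cvg_cst|apply: fc].
have yc : {for t, continuous (fun y => 2 * g y / (f y ^+ 2 + g y ^+ 2 + 1))}.
  by apply: cvgM => //; apply: cvgM; [apply: cvg_cst|apply: gc].
have zc : {for t, continuous
    (fun y => (f y ^+ 2 + g y ^+ 2 - 1) / (f y ^+ 2 + g y ^+ 2 + 1))}.
  by apply: cvgM => //; apply: cvgB; [apply: cvgD|apply: cvg_cst].
exact: (pair_continuous (pair_continuous xc yc) zc).
Qed.

(** Copies of the straight-line drawing of K4, which has width 3, are placed
10 apart: the abscissa of a point determines its copy. *)
Lemma three_K4_embed (G : sgraph) (code : G -> nat * nat) :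
  injective code -> (forall u, (code u).2 < 4)%N ->
  (forall u v, adj u v -> (code u).1 = (code v).1) ->
  embeds_in K G (sphere_with_handles K 0).
Proof.
move=> code_inj code4 code_adj.
pose P (u : G) : K * K :=
  ((K4_point K (code u).2).1 + 10 * (code u).1%:R, (K4_point K (code u).2).2).
pose seg u v (t : K) : K * K :=
  ((1 - t) * (P u).1 + t * (P v).1, (1 - t) * (P u).2 + t * (P v).2).
have x_range i : 0 <= (K4_point K i).1 <= 3.
  by move: i => [|[|[|i]]] /=; lra.
have seg_x u v t : adj u v -> 0 <= t <= 1 ->
    10 * (code u).1%:R <= (seg u v t).1 <= 10 * (code u).1%:R + 3.
  move=> uv /andP[t0 t1]; rewrite /seg /= -(code_adj _ _ uv).
  have := x_range (code u).2; have := x_range (code v).2.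
  move: (K4_point K _).1 (K4_point K _).1 (10 * _) => b a c /andP[? ?] /andP[? ?].
  have -> : (1 - t) * (b + c) + t * (a + c) = (1 - t) * b + t * a + c by ring.
  have : 0 <= (1 - t) * b <= (1 - t) * 3.
    by rewrite mulr_ge0 ?ler_wpM2l //; lra.
  have : 0 <= t * a <= t * 3 by rewrite mulr_ge0 ?ler_wpM2l //; lra.
  by lra.
have copyE (m n : nat) (x : K) : 10 * m%:R <= x <= 10 * m%:R + 3 ->
    10 * n%:R <= x <= 10 * n%:R + 3 -> m = n.
  move=> /andP[h1 h2] /andP[h3 h4].
  have lt_abs (a b : nat) : 10 * a%:R <= x -> x <= 10 * b%:R + 3 -> (a <= b)%N.
    move=> ha hb; rewrite leqNgt; apply/negP => ba.
    have : b.+1%:R <= a%:R :> K by rewrite ler_nat.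
    by rewrite -natr1; lra.
  by apply/eqP; rewrite eqn_leq !lt_abs.
have P_range w : 10 * (code w).1%:R <= (P w).1 <= 10 * (code w).1%:R + 3.
  by have := x_range (code w).2; rewrite /P /=; lra.
have codeE u v : (code u).1 = (code v).1 -> (code u).2 = (code v).2 -> u = v.
  by move=> e1 e2; apply: code_inj; apply: injective_projections.
have adj_neq u v : adj u v -> (code u).2 <> (code v).2.
  move=> uv e2; have := codeE _ _ (code_adj _ _ uv) e2 => uv'.
  by move: uv; rewrite uv' adj_irr.
have P_inj : injective P.
  move=> u v uv; have e1 : (code u).1 = (code v).1.
    by apply: (copyE _ _ (P u).1) => //; rewrite uv.
  apply: codeE => //; apply: (@K4_point_inj K) => //.
  move: uv; rewrite /P e1 => -[/addIr e2 e3].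
  by apply: injective_projections.
have seg_unshift u v t : adj u v ->
    (seg u v t).1 = (1 - t) * (K4_point K (code u).2).1 +
      t * (K4_point K (code v).2).1 + 10 * (code u).1%:R.
  by move=> /code_adj e; rewrite /seg /P /= -e; ring.
have lin_cont (a b : K) : continuous (fun t : K => (1 - t) * a + t * b).
  move=> t; apply: cvgD; apply: cvgM; try exact: cvg_cst; last exact: cvg_id.
  by apply: cvgB; [apply: cvg_cst|apply: cvg_id].
exists (fun u => unstereo (P u)), (fun u v t => unstereo (seg u v t)); split.
- by move=> u v /unstereo_inj/P_inj.
- by move=> v; apply: unstereo_sphere.
- move=> u v uv; split.
  + by apply: continuous_subspaceT; apply: unstereo_continuous; apply: lin_cont.
  + move=> s t _ _ /unstereo_inj[e1 e2].
    have [//|st] := eqVneq s t; exfalso.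
    have h (a b : K) : (1 - s) * a + s * b = (1 - t) * a + t * b -> a = b.
      move=> ab; have : (t - s) * (a - b) = 0.
        transitivity ((1 - s) * a + s * b - ((1 - t) * a + t * b)); first by ring.
        by rewrite ab subrr.
      by move/eqP; rewrite mulf_eq0 !subr_eq0 eq_sym (negPf st) => /eqP.
    have /P_inj uv' : P u = P v by apply: injective_projections; apply: h.
    by move: uv; rewrite uv' adj_irr.
  + by move=> _ [t _ <-]; apply: unstereo_sphere.
  + by split; congr unstereo; apply: injective_projections;
       rewrite /= ?subr0 ?subrr ?mul0r ?mul1r ?addr0 ?add0r.
  + by move=> t _; congr unstereo; apply: injective_projections; rewrite /=; ring.
- move=> u v w t uv; rewrite /= in_itv /= => t01 /unstereo_inj e.
  have t01' : 0 <= t <= 1 by lra.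
  have ew : (code u).1 = (code w).1.
    by apply: (copyE _ _ (P w).1) => //; rewrite -e; apply: seg_x.
  apply: (@K4_edge_vertex K (code u).2 (code v).2 (code w).2 t) => //.
  + exact: adj_neq.
  + by move: (congr1 fst e); rewrite seg_unshift // /P ew /= => /addIr.
  + exact: (congr1 snd e).
- move=> u v u' v' s t uv uv'; rewrite /= !in_itv /= => s01 t01 /unstereo_inj e.
  have s01' : 0 <= s <= 1 by lra.
  have t01' : 0 <= t <= 1 by lra.
  have eu : (code u).1 = (code u').1.
    by apply: (copyE _ _ (seg u v s).1); [|rewrite e]; apply: seg_x.
  have ev := code_adj _ _ uv; have ev' := code_adj _ _ uv'.
  have := @K4_edge_edge K (code u).2 (code v).2 (code u').2 (code v').2 s t
    (code4 _) (code4 _) (code4 _) (code4 _) (adj_neq _ _ uv) (adj_neq _ _ uv') s01 t01.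
  case.
  + by move: (congr1 fst e); rewrite !seg_unshift // eu => /addIr.
  + exact: (congr1 snd e).
  + by case=> e1 e2; left; split; apply: codeE; congruence.
  + by case=> e1 e2; right; split; apply: codeE; congruence.
Qed.

End SphereDrawing.

(** * The commuting graph *)

Section CommutingGraphShape.
Import mathcomp.boot.finset.
Variables (R : finZmodType) (mul : R -> R -> R).
Hypothesis mulDl : left_distributive mul +%R.
Hypothesis mulDr : right_distributive mul +%R.
Hypothesis R4 : n_centralizer mul 4.

Local Notation G := (commuting_graph mul).

Lemma commuting_graph_adj (x y : G) :
  adj x y = (x != y) && (val x - val y \in center mul).
Proof.
rewrite /adj /= /commuting_adj; congr (_ && _).
exact: (commute_center_coset mulDl mulDr R4 (valP x) (valP y)).
Qed.

Lemma commuting_graph_integral : integral_graph G.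
Proof.
have adjE (x y : G) : (x == y) || adj x y = (val x - val y \in center mul).
  rewrite commuting_graph_adj; case: eqVneq => //= ->.
  by rewrite subrr (ring_center0 mulDl mulDr).
apply: (@integral_disjoint_cliques _ #|center mul|) => [y x z|x].
  rewrite !adjE => xy yz; rewrite -(subrKA (val y)).
  exact: ring_centerD.
rewrite (eq_card (B := [pred y : G | val x - val y \in center mul])); last first.
  by move=> y; exact: adjE.
rewrite -(card_imset _ (inj_comp (@subrI _ (val x)) val_inj)).
apply: eq_card => z; apply/imsetP/idP => [[y]|zZ].
  by rewrite inE => h ->; exact: h.
have xz : val x - z \notin center mul.
  apply: contraNN (valP x) => h; rewrite -(subrK z (val x)).
  exact: ring_centerD.
exists (Sub (val x - z) xz : G); first by rewrite inE /= subKr.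
by rewrite /= subKr.
Qed.

Lemma commuting_graph_planar (K : realType) :
  (#|center mul| <= 4)%N -> embeds_in K G (sphere_with_handles K 0).
Proof.
move=> m4; have [rep [rep_nc rep_cover rep_inj]] := noncentral_cosets mulDl mulDr R4.
have codeE (x : G) : exists kz : nat * R, [/\ (kz.1 < 3)%N, kz.2 \in center mul &
    val x = rep kz.1 + kz.2].
  have [k k3 kz] := rep_cover _ (valP x).
  by exists (k, val x - rep k); split=> //=; rewrite addrC subrK.
have [kz kzP] := choice codeE.
pose code (x : G) := ((kz x).1, index (kz x).2 (enum (center mul))).
have mem_kz x : (kz x).2 \in enum (center mul) by have [] := kzP x; rewrite mem_enum.
apply: (@three_K4_embed K G code) => [x y [e1 e2]|x|x y].
- have [_ _ xE] := kzP x; have [_ _ yE] := kzP y.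
  apply: val_inj; rewrite xE yE e1; congr (_ + _).
  by rewrite -(nth_index 0 (mem_kz x)) e2 nth_index.
- by rewrite /code /=; apply: leq_trans m4; rewrite cardE index_mem.
- rewrite commuting_graph_adj => /andP[_].
  have [x3 xZ ->] := kzP x; have [y3 yZ ->] := kzP y => h.
  apply: rep_inj => //.
  have -> : rep (kz x).1 - rep (kz y).1 =
      (rep (kz x).1 + (kz x).2 - (rep (kz y).1 + (kz y).2)) - ((kz x).2 - (kz y).2).
    by rewrite opprD addrACA addrK.
  by apply: ring_centerB => //; apply: ring_centerB.
Qed.

(** Two cosets of noncentral elements provide the copies of K5, and the third
one provides the extra vertex. *)
Lemma commuting_graph_not_embeds (K : realType) (X : topologicalType) (S : set X) :
  (5 <= #|center mul|)%N ->
  (forall p, S p -> exists J : X -> (K * K) * (K * K),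
    [/\ forall x, S x -> x <> p -> {for x, continuous J},
        forall x, S x -> x <> p -> on_torus (J x)
      & forall x y, S x -> S y -> x <> p -> y <> p -> J x = J y -> x = y]) ->
  ~ embeds_in K G S.
Proof.
move=> m5 chart; have [rep [rep_nc rep_cover rep_inj]] := noncentral_cosets mulDl mulDr R4.
pose z i : R := nth 0 (enum (center mul)) i.
have zZ i : (i < 5)%N -> z i \in center mul.
  by move=> i5; rewrite -mem_enum mem_nth // -cardE (leq_trans i5).
pose u0 : G := Sub (rep 2%N) (rep_nc 2%N isT).
pose side (k : bool) : nat := k.
have side3 k : (side k < 3)%N by case: k.
pose w (k : bool) (i : nat) : G := insubd u0 (rep (side k) + z i).
have wE k i : (i < 5)%N -> val (w k i) = rep (side k) + z i.
  move=> i5; apply: insubdK; rewrite unfold_in; apply: contraNN (rep_nc _ (side3 k)) => h.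
  by rewrite -(addrK (z i) (rep _)); apply: ring_centerB => //; apply: zZ.
have rep_diff k l a b : (k < 3)%N -> (l < 3)%N -> (a \in center mul) ->
    b \in center mul -> rep k + a = rep l + b -> k = l.
  move=> k3 l3 aZ bZ e; apply: rep_inj => //.
  have -> : rep k - rep l = b - a.
    by apply/eqP; rewrite subr_eq addrAC eq_sym subr_eq addrC -e.
  exact: ring_centerB.
apply: (@no_embedding_of_two_K5 K X G S w u0) => //
  [k a k' a' a5 a5' /(congr1 val)|k a b ab|k a a5].
- rewrite !wE // => e; have kk := rep_diff _ _ _ _ (side3 k) (side3 k') (zZ _ a5) (zZ _ a5') e.
  have {}kk : k = k' by move: kk; case: (k) (k') => [] [].
  split=> //; move: e; rewrite kk => /addrI/eqP.
  by rewrite nth_uniq ?enum_uniq -?cardE ?(leq_trans _ m5) // => /eqP.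
- have [a5 b5] : (a < 5)%N /\ (b < 5)%N by lia.
  rewrite commuting_graph_adj -(inj_eq val_inj) !wE //; apply/andP; split.
    rewrite (inj_eq (addrI _)) nth_uniq ?enum_uniq -?cardE ?(leq_trans _ m5) //.
    by rewrite neq_ltn; case/andP: ab => ->.
  by rewrite opprD addrACA subrr add0r; apply: ring_centerB => //; apply: zZ.
- apply/eqP => /(congr1 val); rewrite wE //= => e.
  have := rep_diff (side k) 2%N (z a) 0 (side3 k) isT (zZ _ a5) (ring_center0 mulDl mulDr).
  by rewrite addr0 => /(_ e); case: (k).
Qed.

End CommutingGraphShape.

Theorem proposition3p4 (K : realType) (R : finZmodType) (mul : R -> R -> R)
    (mulA : associative mul)
    (mulDl : left_distributive mul +%R) (mulDr : right_distributive mul +%R)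
    (R4 : n_centralizer mul 4) :
  [/\ integral_graph (commuting_graph mul),
      ~ toroidal K (commuting_graph mul)
    & planar K (commuting_graph mul) <->
      #|center mul| = 1%N \/ #|center mul| = 2%N \/
      #|center mul| = 3%N \/ #|center mul| = 4%N].
Proof.
have Z_gt0 : (0 < #|center mul|)%N.
  by apply/card_gt0P; exists 0; apply: ring_center0.
have small : (#|center mul| <= 4)%N ->
    embeds_in K (commuting_graph mul) (sphere_with_handles K 0).
  exact: commuting_graph_planar.
have large0 : (5 <= #|center mul|)%N ->
    ~ embeds_in K (commuting_graph mul) (sphere_with_handles K 0).
  by move=> m5; apply: commuting_graph_not_embeds => //; apply: punctured_sphere_chart.
have large1 : (5 <= #|center mul|)%N ->
    ~ embeds_in K (commuting_graph mul) (sphere_with_handles K 1).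
  move=> m5; apply: commuting_graph_not_embeds => // p _.
  have [J [Jc Jt Ji]] := torus_chart K.
  by exists J; split=> [x Sx _|x Sx _|x y Sx Sy _ _]; auto.
split; first exact: commuting_graph_integral.
- move=> [h1 h0]; have [m4|m5] := leqP #|center mul| 4.
    exact: h0 (small m4).
  exact: large1 m5 h1.
- split=> [[h0 _]|m4].
    have [m4|m5] := leqP #|center mul| 4; last by case: (large0 m5).
    by move: Z_gt0 m4; case: #|_| => [|[|[|[|[|]]]]] //; tauto.
  split; last by [].
  by apply: small; case: m4 => [|[|[|]]] ->.
Qed.
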